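(* The set $$\Pi_{12}(\mathcal{F}^4)=\{(f_1(P),f_2(P)) : P \text{ is a } 4\text{-dimensional convex polytope}\}\subset\mathbb{Z}^2$$ is not an $\mathbb{R}$-semi-algebraic set of lattice points.
   Context: Polytopes are convex polytopes; $f_i(P)$ denotes the number of $i$-dimensional faces of $P$ (so $f_1$ counts edges and $f_2$ counts $2$-faces). A basic semi-algebraic set in $\mathbb{R}^n$ is a subset defined by finitely many polynomial equations and (strict or non-strict) polynomial inequalities with real coefficients; a ($\mathbb{R}$-)semi-algebraic set is a finite union of basic semi-algebraic sets. An affine lattice $\Lambda\subset\mathbb{R}^n$ is a translate of a linear lattice, i.e. a discrete subset closed under affine combinations $\lambda_1a_1+\dots+\lambda_ma_m$ with $m\ge1$, $\lambda_i\in\mathbb{Z}$, $\sum\lambda_i=1$ (not necessarily of full rank); only lattices $\Lambda\subseteq\mathbb{Z}^n$ are considered. A set $A\subset\mathbb{R}^n$ is an $\mathbb{R}$-semi-algebraic set of lattice points if $A=S\cap\Lambda$ for some semi-algebraic set $S\subseteq\mathbb{R}^n$ and some affine lattice $\Lambda$. *)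

(* Defs.v *)
From HB Require Import structures.
From mathcomp Require Import all_boot all_order all_algebra.
From mathcomp Require Import finmap.
From mathcomp Require Import boolp classical_sets functions cardinality.
From mathcomp Require Import reals topology normedtype.
(* Not imported: the notations of mpoly clash with those of analysis. *)
From mathcomp Require mpoly.

Set Implicit Arguments.
Unset Strict Implicit.
Unset Printing Implicit Defensive.

Import Order.TTheory GRing.Theory Num.Theory.
Import numFieldNormedType.Exports.

Local Open Scope classical_set_scope.
Local Open Scope ring_scope.

Section Polytopes.
Variables (R : realType) (m : nat).
Implicit Types (A V P F : set 'rV[R]_m).

Definition affine_hull A : set 'rV[R]_m :=
  [set x | exists (k : nat) (a : 'I_k -> 'rV[R]_m) (t : 'I_k -> R),
    [/\ forall i, A (a i), \sum_i t i = 1 & x = \sum_i t i *: a i]].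

Definition convex_hull A : set 'rV[R]_m :=
  [set x | exists (k : nat) (a : 'I_k -> 'rV[R]_m) (t : 'I_k -> R),
    [/\ forall i, A (a i), forall i, 0 <= t i, \sum_i t i = 1
      & x = \sum_i t i *: a i]].

(* Never holds for the empty set, whose dimension is -1 by convention. *)
Definition has_dim (d : nat) A : Prop :=
  exists (a : 'rV[R]_m) (U : {vspace 'rV[R]_m}),
    \dim U = d /\ affine_hull A = [set a + u | u in [set u | u \in U]].

Definition polytope P : Prop :=
  exists2 V, finite_set V & P = convex_hull V.

(* The improper faces set0 and P are included (take c = 0). *)
Definition is_face P F : Prop :=
  exists (c : 'cV[R]_m) (b : R),
    (forall x, P x -> (x *m c) 0 0 <= b) /\
    F = P `&` [set x | (x *m c) 0 0 = b].

Definition faces (i : nat) P : set (set 'rV[R]_m) :=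
  [set F | is_face P F /\ has_dim i F].

(* fset_set sends infinite sets to fset0; a polytope has finitely many faces. *)
Definition f_ (i : nat) P : nat := #|` fset_set (faces i P)|.

End Polytopes.

Definition Pi12_F4 (R : realType) : set 'rV[R]_2 :=
  [set x : 'rV[R]_2 | exists (m : nat) (P : set 'rV[R]_m),
    [/\ polytope P, has_dim 4 P,
        x 0 0 = (f_ 1 P)%:R & x 0 1 = (f_ 2 P)%:R]].

Section SemiAlgebraic.
Variables (R : realType) (n : nat).
Implicit Types (S A L : set 'rV[R]_n).

Definition peval (p : mpoly.mpoly n R) (x : 'rV[R]_n) : R :=
  mpoly.meval (fun j => x 0 j) p.

Definition basic_semialgebraic S : Prop :=
  exists eqs ges gts : seq (mpoly.mpoly n R),
    S = [set x | [/\ all (fun p => peval p x == 0) eqs,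
                     all (fun p => 0 <= peval p x) ges
                   & all (fun p => 0 < peval p x) gts]].

Definition semialgebraic S : Prop :=
  exists (k : nat) (B : 'I_k -> set 'rV[R]_n),
    (forall i, basic_semialgebraic (B i)) /\ S = \bigcup_i B i.

Definition affine_lattice L : Prop :=
  [/\ L !=set0,
      L `<=` isolated L
    & forall (k : nat) (a : 'I_k -> 'rV[R]_n) (t : 'I_k -> int),
        (forall i, L (a i)) -> \sum_i t i = 1 -> L (\sum_i a i *~ t i)].

Definition integral_points : set 'rV[R]_n :=
  [set x : 'rV[R]_n | forall j, x 0 j \is a Num.int].

Definition semialgebraic_lattice_points A : Prop :=
  exists S L, [/\ semialgebraic S, affine_lattice L, L `<=` integral_points
                & A = S `&` L].

End SemiAlgebraic.

(* Main.v *)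
Require Import Defs.
From HB Require Import structures.
From mathcomp Require Import all_boot all_order all_algebra.
From mathcomp Require Import boolp.
From mathcomp Require Import zify ring lra.
From mathcomp Require mpoly.

(** A univariate polynomial has an eventually constant sign, so a semi-algebraic
    set is eventually constant along any polynomial curve
    ([eventually_decided_curve]). It is therefore enough to find a polynomial
    curve that meets the lattice infinitely often in pairs (f_1, f_2) of
    4-polytopes and infinitely often in other points. The curve is
    (8 t^2 + t, 16 t^2 - 6 t - 2); the first points have t = k and the second
    ones t = k - 1/8, for integers k > 1.

    Put u = f_1 - f_2 / 2. Euler's relation and 2 f_3 <= f_2 give f_0 <= u, and
    f_1 <= C(f_0, 2) since an edge is determined by its ends. If f_2 is even this
    says f_1 <= C(u, 2). If f_2 is odd, u is a half-integer, so that f_0 <= u - 1/2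
    and f_1 <= C(u - 1/2, 2), which is smaller by about u / 2
    ([rk5_bounds]). On the curve u = 4 t + 1 and f_1 = C(u, 2) - t, between
    these two bounds. At t = k - 1/8 the second bound is violated ([curve_out]).
    At t = k the point belongs to a simplicial polytope with u vertices, k pairs of
    which are not edges ([curve_in]).

    Such polytopes are built from a cyclic polytope by adding one vertex beyond some of
    the facets around one edge. The new vertex is joined to the ends of that edge and
    to the vertices of these facets, and no old edge is lost, so that the number of
    missing edges can be prescribed ([family_edges]). Since all facets are simplices,
    f_2 follows from Euler's relation ([family_2faces]).

    The points at t = k - 1/8 are in the lattice because the pairs (15, 18), (14, 16)
    and (13, 13) of polytopes with six vertices generate Z^2 by integral affine
    combinations ([lattice_has_integral_points]). The last pair comes from the two-fold
    pyramid over a square, which has an odd number of 2-faces.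

    The combinatorics of a polytope with vertices v_i is read off the vector space [W]
    of all slack vectors (b - <v_i, c>)_i. Faces are the zero sets of nonnegative
    vectors of [W]; a face figure is obtained by passing to the subspace of the vectors
    that vanish on the face, and a face by forgetting coordinates. In this setting
    Euler's relation has a short inductive proof in any dimension ([euler_low]). *)

Set Implicit Arguments.
Unset Strict Implicit.
Unset Printing Implicit Defensive.

Import Order.TTheory GRing.Theory Num.Theory.
Local Open Scope ring_scope.

(** * Rank of a set of coordinates *)

Section Rank.
Variables (K : fieldType) (I : finType).
Local Notation vecs := {ffun I -> K^o}.
Implicit Types (W : {vspace vecs}) (S T : {set I}) (y : vecs).

Definition restrict S y : vecs := [ffun i => if i \in S then y i else 0].

Fact restrict_is_linear S : linear (restrict S).
Proof.
move=> a x y; apply/ffunP => i; rewrite !ffunE.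
by case: ifP => _; rewrite ?ffunE // scaler0 addr0.
Qed.

HB.instance Definition _ S :=
  GRing.isLinear.Build K vecs vecs _ (restrict S) (restrict_is_linear S).

Definition vanish S : {vspace vecs} := lker (linfun (restrict S)).

Lemma vanishP S y : reflect {in S, forall i, y i = 0} (y \in vanish S).
Proof.
rewrite memv_ker lfunE; apply: (iffP eqP) => [/ffunP y0 i iS | y0].
  by have := y0 i; rewrite !ffunE iS.
by apply/ffunP => i; rewrite !ffunE; case: ifP => // /y0.
Qed.

Lemma vanishS S T : S \subset T -> (vanish T <= vanish S)%VS.
Proof.
by move=> /subsetP ST; apply/subvP => y /vanishP y0; apply/vanishP => i /ST/y0.
Qed.

(** For slack vectors this is the rank of the homogenized points of [S], that is, one
    more than the dimension of their affine hull. *)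
Definition rk W S : nat := (\dim W - \dim (W :&: vanish S))%N.

Lemma rkE W S : (rk W S + \dim (W :&: vanish S) = \dim W)%N.
Proof. by rewrite subnK // dimvS // capvSl. Qed.

Lemma rk_subset W S T : S \subset T -> (rk W S <= rk W T)%N.
Proof. by move=> ST; apply/leq_sub2l/dimvS/capvS/vanishS. Qed.

Lemma rk_ltn W S T y :
    S \subset T -> y \in W -> y \in vanish S -> y \notin vanish T ->
  (rk W S < rk W T)%N.
Proof.
move=> ST yW yS yT; have := rkE W S; have := rkE W T.
have : (\dim (W :&: vanish T) < \dim (W :&: vanish S))%N.
  have sub : (W :&: vanish T <= W :&: vanish S)%VS by apply/capvS/vanishS.
  rewrite (ltn_leqif (dimv_leqif_sup sub)); apply/negP => /subvP/(_ y).
  by rewrite !memv_cap yW yS => /(_ isT) /= yT'; rewrite yT' in yT.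
lia.
Qed.

Lemma rk_closure W S T :
    S \subset T -> (forall y, y \in W -> y \in vanish S -> y \in vanish T) ->
  rk W T = rk W S.
Proof.
move=> ST clos; apply/anti_leq; rewrite (rk_subset _ ST) andbT.
apply/leq_sub2l/dimvS/subvP => y; rewrite !memv_cap => /andP[yW yS].
by rewrite yW clos.
Qed.

Lemma rk0 W S : (W <= vanish S)%VS -> rk W S = 0%N.
Proof. by move=> /capv_idPl; rewrite /rk => ->; rewrite subnn. Qed.

Lemma rk_set0 W : rk W set0 = 0%N.
Proof. by apply/rk0/subvP => y _; apply/vanishP => i; rewrite inE. Qed.

(** The vectors of [W] vanishing on [S] play the part of a quotient by [S]; ranks are
    additive, as in a contraction of matroids. *)
Lemma rk_link W S T :
  S \subset T -> (rk W T = rk W S + rk (W :&: vanish S) T)%N.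
Proof.
move=> ST; apply: (@addIn (\dim (W :&: vanish T))).
have := rkE (W :&: vanish S) T; rewrite -capvA (capv_idPr (vanishS ST)) => eqT.
by rewrite -addnA eqT !rkE.
Qed.

Definition coord_at (i : I) (y : vecs) : K^o := y i.

Fact coord_at_is_linear i : linear (coord_at i).
Proof. by move=> a x y; rewrite /coord_at !ffunE. Qed.

HB.instance Definition _ i :=
  GRing.isLinear.Build K vecs K^o _ (coord_at i) (coord_at_is_linear i).

(** A single coordinate is one linear form on the vectors that vanish on [S]. *)
Lemma rk_setU1 W S i : (rk W (i |: S) <= (rk W S).+1)%N.
Proof.
have -> : rk W (i |: S) = (rk W S + rk (W :&: vanish S) (i |: S))%N.
  exact/rk_link/subsetUr.
rewrite -addn1 leq_add2l; set U := (W :&: vanish S)%VS.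
have -> : rk U (i |: S) = \dim (linfun (coord_at i) @: U).
  have := rkE U (i |: S); rewrite -(limg_ker_dim (linfun (coord_at i)) U) addnC.
  suff -> : (U :&: vanish (i |: S) = U :&: lker (linfun (coord_at i)))%VS.
    exact: addnI.
  apply/vspaceP => y; rewrite !memv_cap (memv_ker (linfun (coord_at i))) lfunE /=.
  apply/andP/andP => -[/[dup] yU /andP[_ /vanishP yS]].
    by move=> /vanishP/(_ i (setU11 _ _)) yi; split=> //; apply/eqP.
  by move=> /eqP yi; split=> //; apply/vanishP => k /setU1P[->|/yS].
by apply: leq_trans (dimvS (subvf _)) _; rewrite dimvf.
Qed.

Lemma rk_setU_leq W S T : (rk W (S :|: T) <= rk W S + #|T|)%N.
Proof.
have [n nT] := ubnP #|T|; elim: n T nT => // n IHn T.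
have [->|[i iT]] := set_0Vmem T; first by rewrite setU0 cards0 addn0.
rewrite (cardsD1 i) iT add1n ltnS => /IHn le.
rewrite addnS -{1}(setD1K iT) setUCA.
exact: leq_trans (rk_setU1 _ _ _) _.
Qed.

Lemma rk_card W S : (rk W S <= #|S|)%N.
Proof. by have := rk_setU_leq W set0 S; rewrite set0U rk_set0. Qed.

End Rank.

(** * Faces of a space of vectors *)

Section Cone.
Variables (R : realFieldType) (I : finType).
Local Notation vecs := {ffun I -> R^o}.
Local Notation vanish := (vanish R).
Implicit Types (W : {vspace vecs}) (J F G T B : {set I}) (y h f : vecs).

Definition zeros J y : {set I} := [set i in J | y i == 0].

(** Homogeneous encoding of a face lattice: [W] stands for the affine functions on the
    points of [J], and a face is cut out by a function that is nonnegative on [J]. Faces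
    are reached by shrinking [J] and face figures by shrinking [W], so that all of them
    live over the same index type. *)
Definition cone_faces W J : {set {set I}} :=
  [set F | `[< exists2 y, y \in W &
                 {in J, forall i, 0 <= y i} /\ F = zeros J y >]].

Lemma cone_facesP W J F :
  reflect (exists2 y, y \in W & {in J, forall i, 0 <= y i} /\ F = zeros J y)
          (F \in cone_faces W J).
Proof. by rewrite inE; apply: asboolP. Qed.

Lemma mem_zeros J y i : (i \in zeros J y) = (i \in J) && (y i == 0).
Proof. by rewrite inE. Qed.

Lemma zeros_vanish J y : y \in vanish (zeros J y).
Proof. by apply/vanishP => i; rewrite inE => /andP[_ /eqP]. Qed.

Lemma cone_face_sub W J F : F \in cone_faces W J -> F \subset J.
Proof.
by move=> /cone_facesP[y _ [_ ->]]; apply/subsetP => i; rewrite inE => /andP[].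
Qed.

Lemma cone_face_full W J : J \in cone_faces W J.
Proof.
apply/cone_facesP; exists 0; first exact: mem0v.
split=> [i _|]; first by rewrite ffunE.
by apply/setP => i; rewrite inE ffunE eqxx andbT.
Qed.

Lemma cone_face_cap W J F G :
  F \in cone_faces W J -> G \in cone_faces W J -> F :&: G \in cone_faces W J.
Proof.
move=> /cone_facesP[y yW [y0 ->]] /cone_facesP[z zW [z0 ->]].
apply/cone_facesP; exists (y + z); first exact: memvD.
split=> [i iJ|]; first by rewrite ffunE addr_ge0 ?y0 ?z0.
apply/setP => i; rewrite !inE ffunE.
by case: (boolP (i \in J)) => //= iJ; rewrite paddr_eq0 ?y0 ?z0.
Qed.

(** This makes [W :&: vanish T] the face figure of [T]. *)
Lemma cone_faces_link W J T F : T \in cone_faces W J ->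
  (F \in cone_faces (W :&: vanish T) J) = (F \in cone_faces W J) && (T \subset F).
Proof.
move=> /cone_face_sub /subsetP TJ.
apply/cone_facesP/andP => [[y /memv_capP[yW /vanishP yT] [y0 ->]]|].
  split; first by apply/cone_facesP; exists y.
  by apply/subsetP => i iT; rewrite inE TJ //= yT.
move=> [/cone_facesP[y yW [y0 ->]] /subsetP sub].
exists y => //; apply/memv_capP; split=> //.
by apply/vanishP => i /sub; rewrite inE => /andP[_ /eqP].
Qed.

(** The perturbation behind [cone_faces_face] and [euler_low]. *)
Lemma dominate (S : {set I}) y z : {in S, forall i, 0 < z i} ->
  exists k : R, {in S, forall i, 0 < k * z i + y i}.
Proof.
move=> z0; exists (\sum_(i in S) (`|y i| + 1) / z i) => i iS.
have le : (`|y i| + 1) / z i <= \sum_(i in S) (`|y i| + 1) / z i.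
  rewrite (bigD1 i) //= lerDl sumr_ge0 // => k /andP[kS _].
  by rewrite divr_ge0 ?addr_ge0 // ltW // z0.
have := ler_wpM2r (ltW (z0 _ iS)) le; rewrite divfK ?gt_eqF ?z0 // => {}le.
have := ler_norm (- y i); rewrite normrN; lra.
Qed.

(** A face of a face is a face: to a function exposing [F] in [B] add a large multiple of
    one exposing [B] in [J]. *)
Lemma cone_faces_face W J B F : B \in cone_faces W J ->
  (F \in cone_faces W B) = (F \in cone_faces W J) && (F \subset B).
Proof.
move=> BJ; have /subsetP subBJ := cone_face_sub BJ.
apply/idP/andP => [FB|[/cone_facesP[y yW [y0 ->]] /subsetP sub]]; last first.
  apply/cone_facesP; exists y => //; split=> [i /subBJ /y0 //|].
  apply/setP => i; rewrite !inE; case: (boolP (i \in B)) => [/subBJ -> //|].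
  by move=> /negP iB; apply/negP => iJ; apply/iB/sub; rewrite inE.
split; last exact: cone_face_sub FB.
have /cone_facesP[y yW [y0 ->]] := FB.
have /cone_facesP[z zW [z0 eqB]] := BJ.
have [|k kP] := @dominate (J :\: B) y z.
  move=> i /setDP[iJ]; rewrite eqB inE iJ /= => zi.
  by rewrite lt_def zi z0.
have zB i : i \in B -> z i = 0 by rewrite eqB inE => /andP[_ /eqP].
apply/cone_facesP; exists (k *: z + y); first by rewrite memvD ?memvZ.
split=> [i iJ|].
  rewrite !ffunE; case: (boolP (i \in B)) => iB; last first.
    by apply/ltW/kP/setDP.
  by rewrite zB // scaler0 add0r y0.
apply/setP => i; rewrite !inE !ffunE; case: (boolP (i \in B)) => iB.
  by rewrite zB // scaler0 add0r subBJ.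
case: (boolP (i \in J)) => //= iJ; apply/esym/negbTE.
by rewrite gt_eqF // kP // inE iJ iB.
Qed.

Lemma cone_face_rk_lt W J F G : F \in cone_faces W J ->
  F \subset G -> G \subset J -> F != G -> (rk W F < rk W G)%N.
Proof.
move=> /cone_facesP[y yW [y0 eqF]] FG /subsetP GJ neq.
apply: (rk_ltn FG yW); first by rewrite eqF zeros_vanish.
apply: contra neq => /vanishP yG; rewrite eqEsubset FG /=.
by apply/subsetP => i iG; rewrite eqF inE GJ //= yG.
Qed.

(** [F] is then the least face, which corresponds to the empty face of a polytope: the
    set [set0] for the polytope itself, and [T] in the face figure of [T]. *)
Definition pointed W J F := (W <= vanish F)%VS /\ F \in cone_faces W J.

Lemma pointed_link W J T :
  T \in cone_faces W J -> pointed (W :&: vanish T) J T.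
Proof. by move=> TJ; split; rewrite ?capvSr // cone_faces_link // TJ subxx. Qed.

Lemma pointed_min W J F0 F :
  pointed W J F0 -> F \in cone_faces W J -> F0 \subset F.
Proof.
move=> [/subvP W0 /cone_face_sub /subsetP sub] /cone_facesP[y /W0/vanishP y0 [_ ->]].
by apply/subsetP => i iF; rewrite inE sub //= y0.
Qed.

Lemma pointed_face W J F0 B :
  pointed W J F0 -> B \in cone_faces W J -> pointed W B F0.
Proof.
move=> pt BJ; have [W0 FJ] := pt; split=> //.
by rewrite (cone_faces_face _ BJ) FJ (pointed_min pt).
Qed.

Lemma pointed_rk0 W J F0 : pointed W J F0 -> rk W F0 = 0%N.
Proof. by move=> [W0 _]; apply: rk0. Qed.

(** Minimize the ratio [f / h]: the minimizers form a face, since [f - mu *: h] is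
    nonnegative on [J]. *)
Lemma bottom_face W J F0 h f :
    h \in W -> f \in W -> {in J, forall i, 0 <= h i} -> F0 = zeros J h ->
    (W <= vanish F0)%VS -> F0 != J ->
  exists mu, [/\ {in J, forall i, mu * h i <= f i},
                 zeros J (f - mu *: h) \in cone_faces W J &
                 exists2 i, i \in J :\: F0 & f i = mu * h i].
Proof.
move=> hW fW h0 eqF /subvP /(_ f fW) /vanishP fF neq.
have hpos i : i \in J :\: F0 -> 0 < h i.
  by move=> /setDP[iJ]; rewrite eqF inE iJ /= => hi; rewrite lt_def hi h0.
have [i0 i0J] : exists i, i \in J :\: F0.
  apply/set0Pn; apply: contra neq; rewrite setD_eq0 => sub.
  by rewrite eqEsubset sub andbT eqF; apply/subsetP => i; rewrite inE => /andP[].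
case: (arg_minP (fun i => f i / h i) i0J) => i iJ imin.
exists (f i / h i).
have le : {in J, forall k, f i / h i * h k <= f k}.
  move=> k kJ; case: (boolP (k \in F0)) => kF.
    rewrite (fF k kF); move: kF; rewrite eqF inE => /andP[_ /eqP ->].
    by rewrite mulr0.
  by rewrite -ler_pdivlMr ?hpos ?imin //; apply/setDP.
split=> //; last by exists i => //; rewrite divfK // gt_eqF // hpos.
apply/cone_facesP; exists (f - (f i / h i) *: h); first by rewrite memvB ?memvZ.
by split=> // k kJ; rewrite !ffunE subr_ge0 le.
Qed.

(** * Euler's relation *)

Definition nonneg_on J f := [forall i in J, 0 <= f i].

(** The least face and the faces strictly on the negative side of the hyperplane [f = 0].
    For [f = - h] these are all the faces, so that Euler's relation and its version for one
    side of a hyperplane come out of the same induction. *)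
Definition low_faces W J F0 f :=
  [set F in cone_faces W J | [forall i in F :\: F0, f i < 0]].

Lemma in_low W J F0 f F : (F \in low_faces W J F0 f) =
  (F \in cone_faces W J) && [forall i in F :\: F0, f i < 0].
Proof. by rewrite in_set. Qed.

(** Sort the low faces by their top, the subface on which the ratio [f / h] is largest.
    The low faces with top [T] are the low faces of the face figure of [T] with respect
    to [f - lam *: h], where [lam] is the value of the ratio on [T]. By induction their
    alternating sum vanishes unless this function is nonnegative, which means that [T]
    lies in the face [B] on which the ratio is least. What is left is the alternating sum
    over all faces of [B], which vanishes by induction as well. Tops of every dimension are
    allowed, so ties of the ratio do no harm. If [f] is not proportional to [h] then [B]
    is a proper face, of smaller rank. *)
Lemma euler_low_step W J F0 h f :
    (forall W' J' F' f', (rk W' J' < rk W J)%N -> pointed W' J' F' -> f' \in W' ->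
       \sum_(F in low_faces W' J' F' f') (-1) ^+ rk W' F =
       (nonneg_on J' f')%:R :> int) ->
    h \in W -> {in J, forall i, 0 <= h i} -> F0 = zeros J h ->
    (W <= vanish F0)%VS -> f \in W ->
    (exists2 i, i \in J & f i < 0) ->
    (forall mu : R, exists2 i, i \in J & f i != mu * h i) ->
  \sum_(F in low_faces W J F0 f) (-1) ^+ rk W F = 0 :> int.
Proof.
move=> IH hW h0 eqF0 W0 fW [ineg inegJ fneg] nprop.
have F0face : F0 \in cone_faces W J by apply/cone_facesP; exists h.
have pt : pointed W J F0 by [].
have F0J : F0 \subset J := cone_face_sub F0face.
have /vanishP f0 := subvP W0 _ fW.
have hpos i : i \in J -> i \notin F0 -> 0 < h i.
  by move=> iJ; rewrite eqF0 inE iJ /= => hi; rewrite lt_def hi h0.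
have hF0 i : i \in F0 -> h i = 0 by rewrite eqF0 inE => /andP[_ /eqP].
have neq : F0 != J.
  by apply/eqP => eqJ; move: fneg; rewrite f0 ?eqJ // ltxx.
have [mu [lemu Bface [imu /setDP[imuJ imuF0] fmu]]] :=
  bottom_face hW fW h0 eqF0 W0 neq.
set B := zeros J (f - mu *: h) in Bface.
have memB i : (i \in B) = (i \in J) && (f i == mu * h i).
  by rewrite inE !ffunE subr_eq0.
have mu0 : mu < 0.
  have hi : 0 < h ineg.
    by apply: hpos => //; apply: contraTN fneg => /f0 ->; rewrite ltxx.
  have := lemu _ inegJ; rewrite -(pmulr_llt0 _ hi); lra.
have F0B : F0 \subset B := pointed_min pt Bface.
have BJ : B \subset J := cone_face_sub Bface.
have rkB : (rk W B < rk W J)%N.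
  apply: (cone_face_rk_lt Bface BJ (subxx _)); apply/eqP => eqB.
  by have [i iJ /negP] := nprop mu; apply; move: iJ; rewrite -{1}eqB memB => /andP[].
pose ratio i := f i / h i.
have ratioK i : i \in J -> i \notin F0 -> f i = ratio i * h i.
  by move=> iJ iF; rewrite divfK // gt_eqF // hpos.
pose top F := [set i in F | (i \in F0) ||
                 [forall k in F :\: F0, ratio k <= ratio i]].
have top_sub F : top F \subset F by apply/subsetP => i; rewrite inE => /andP[].
pose good T := [&& T \in low_faces W J F0 f, T != F0 & top T == T].
(* A top exists and is a zero set, hence a face. *)
have topP F : F \in low_faces W J F0 f -> F != F0 ->
  exists2 i, i \in F :\: F0 & {in F :\: F0, forall k, ratio k <= ratio i}.
  rewrite in_low => /andP[Fface _] FF0.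
  have [i0 i0F] : exists i, i \in F :\: F0.
    apply/set0Pn; apply: contra FF0; rewrite setD_eq0 => sub.
    by rewrite eqEsubset sub (pointed_min pt).
  by case: (arg_maxP ratio i0F) => i iF imax; exists i.
have topE F i : F \in low_faces W J F0 f -> i \in F :\: F0 ->
    {in F :\: F0, forall k, ratio k <= ratio i} ->
    top F = zeros F (f - ratio i *: h).
  rewrite in_low => /andP[Fface _] /setDP[iF iF0] imax.
  have /subsetP FJ := cone_face_sub Fface.
  apply/setP => k; rewrite !inE !ffunE subr_eq0.
  case: (boolP (k \in F)) => //= kF; case: (boolP (k \in F0)) => /= kF0.
    by rewrite f0 // hF0 // scaler0 eqxx.
  rewrite ratioK ?FJ // (inj_eq (mulIf (lt0r_neq0 (hpos _ (FJ _ kF) kF0)))).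
  apply/forall_inP/eqP => [kmax|-> k' /imax//].
  by apply/le_anti; rewrite kmax ?imax //; apply/setDP.
have top_good F : F \in low_faces W J F0 f -> F != F0 -> good (top F).
  move=> Flow FF0; have [i iF imax] := topP F Flow FF0.
  have /setDP[iF' iF0] := iF.
  have Fface : F \in cone_faces W J by move: Flow; rewrite in_low => /andP[].
  have /subsetP FJ := cone_face_sub Fface.
  have tface : top F \in cone_faces W F.
    apply/cone_facesP; exists (ratio i *: h - f).
      by rewrite memvB ?memvZ.
    split=> [k kF|]; last first.
      rewrite (topE _ _ Flow iF imax); apply/setP => k; rewrite !inE.
      by rewrite -oppr_eq0 !ffunE opprB.
    rewrite !ffunE subr_ge0; case: (boolP (k \in F0)) => kF0.
      by rewrite f0 // hF0 // scaler0.
    by rewrite ratioK ?FJ // ler_wpM2r ?h0 ?FJ // imax //; apply/setDP.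
  have itop : i \in top F.
    by rewrite inE iF' (negbTE iF0) /=; apply/forall_inP.
  rewrite /good; apply/and3P; split.
  - move: tface; rewrite (cone_faces_face _ Fface) in_low => /andP[-> _] /=.
    apply/forall_inP => k /setDP[ktop kF0].
    move: Flow; rewrite in_low => /andP[_ /forall_inP]; apply; apply/setDP.
    by split=> //; apply: (subsetP (top_sub F)).
  - by apply: contraNneq iF0 => <-.
  rewrite eqEsubset top_sub; apply/subsetP => k ktop.
  rewrite inE ktop /=; move: ktop; rewrite inE => /andP[_ /orP[-> //|]].
  move=> /forall_inP kmax; apply/orP; right; apply/forall_inP => k' /setDP[k'F k'F0].
  by apply: kmax; apply/setDP; split=> //; apply: (subsetP (top_sub F)).
(* Low faces with a given top, as low faces of a face figure. *)
have inner T : good T ->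
    \sum_(F in low_faces W J F0 f | (F != F0) && (top F == T)) (-1) ^+ rk W F
    = if T \subset B then (-1) ^+ rk W T else 0 :> int.
  rewrite /good => /and3P[Tlow TF0 /eqP topT].
  have [i iT imax] := topP T Tlow TF0.
  have Tface : T \in cone_faces W J by move: Tlow; rewrite in_low => /andP[].
  have /subsetP TJ := cone_face_sub Tface.
  have ratioT k : k \in T -> f k = ratio i * h k.
    rewrite -topT (topE _ _ Tlow iT imax) inE => /andP[_].
    by rewrite !ffunE subr_eq0 => /eqP.
  have /setDP[iT' iF0] := iT.
  have ratio_neg : ratio i < 0.
    rewrite -(pmulr_llt0 _ (hpos _ (TJ _ iT') iF0)) -ratioT //.
    by move: Tlow; rewrite in_low => /andP[_ /forall_inP/(_ _ iT)].
  set g := f - ratio i *: h.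
  have gE k : g k = f k - ratio i * h k by rewrite !ffunE.
  have gW : g \in (W :&: vanish T)%VS.
    rewrite memv_cap memvB ?memvZ //=; apply/vanishP => k kT.
    by rewrite gE ratioT // subrr.
  have rkT : (0 < rk W T)%N.
    rewrite -(pointed_rk0 pt).
    apply: (cone_face_rk_lt F0face (pointed_min pt Tface) (cone_face_sub Tface)).
    by rewrite eq_sym.
  transitivity (\sum_(F in low_faces (W :&: vanish T) J T g)
      (-1) ^+ rk W T * (-1) ^+ rk (W :&: vanish T) F : int).
    rewrite (eq_bigl (fun F => F \in low_faces (W :&: vanish T) J T g)); last first.
      move=> F; rewrite /= [RHS]in_low cone_faces_link //.
      apply/and3P/andP => [[Flow FF0 /eqP topF]|[/andP[Fface TF] /forall_inP Flow]].
        have Fface : F \in cone_faces W J by move: Flow; rewrite in_low => /andP[].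
        have /subsetP FJ := cone_face_sub Fface.
        split; first by rewrite Fface -topF top_sub.
        apply/forall_inP => k /setDP[kF kT].
        have kF0 : k \notin F0.
          by apply: contra kT => kF0; rewrite -topF inE kF kF0.
        move: kT; rewrite -topF inE kF (negbTE kF0) /= negb_forall_in.
        move=> /exists_inP[k' k'F]; rewrite -ltNge => lt1.
        have le2 : ratio k' <= ratio i.
          have : i \in top F by rewrite topF.
          by rewrite inE (negbTE iF0) => /andP[_ /forall_inP]; apply.
        rewrite gE subr_lt0 ratioK ?FJ // ltr_pM2r ?hpos ?FJ //.
        exact: lt_le_trans le2.
      have /subsetP FJ := cone_face_sub Fface.
      have FF0 : F != F0.
        by apply: contraNneq iF0 => <-; apply: (subsetP TF).
      have rF k : k \in F :\: F0 -> ratio k <= ratio i /\ (k \notin T -> ratio k < ratio i).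
        move=> /setDP[kF kF0]; case: (boolP (k \in T)) => kT.
          by split=> //; apply: imax; apply/setDP.
        suff lt : ratio k < ratio i by split=> //; apply: ltW.
        have : g k < 0 by apply: Flow; apply/setDP.
        by rewrite gE subr_lt0 ratioK ?FJ // ltr_pM2r ?hpos ?FJ.
      have Flow' : F \in low_faces W J F0 f.
        rewrite in_low Fface; apply/forall_inP => k kF.
        have /setDP[kF' kF0] := kF.
        rewrite ratioK ?FJ // pmulr_llt0 ?hpos ?FJ //.
        exact: le_lt_trans (rF _ kF).1 ratio_neg.
      split=> //; apply/eqP/setP => k.
      have iF : i \in F :\: F0 by apply/setDP; split=> //; apply: (subsetP TF).
      rewrite (topE _ _ Flow' iF) => [|k' /rF[] //].
      rewrite inE -/g; apply/andP/idP => [[kF /eqP gk]|kT]; last first.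
        by split; [apply: (subsetP TF) | rewrite gE ratioT // subrr].
      apply: contraTT isT => kT.
      by have := Flow k; rewrite gk ltxx; apply; apply/setDP.
    apply: eq_bigr => F; rewrite in_low cone_faces_link // => /andP[/andP[_ TF] _].
    by rewrite (rk_link W TF) exprD.
  rewrite -mulr_sumr (IH _ _ _ _ _ (pointed_link Tface) gW); last first.
    by rewrite (rk_link W (cone_face_sub Tface)) -[X in (X < _)%N]add0n ltn_add2r.
  have -> : nonneg_on J g = (T \subset B).
    apply/forall_inP/subsetP => [gge k kT|sub k kJ].
      rewrite memB TJ //= ratioT //.
      suff -> : ratio i = mu by [].
      apply/le_anti/andP; split.
        rewrite -(ler_pM2r (hpos _ imuJ imuF0)) -fmu -subr_ge0 -gE.
        exact: gge.
      rewrite -(ler_pM2r (hpos _ (TJ _ iT') iF0)) -ratioT //.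
      exact/lemu/TJ.
    have := sub _ iT'; rewrite memB ratioT // => /andP[_].
    rewrite (inj_eq (mulIf (lt0r_neq0 (hpos _ (TJ _ iT') iF0)))) => /eqP eqr.
    by rewrite gE eqr subr_ge0 lemu.
  by case: ifP => _; rewrite ?mulr1 ?mulr0.
(* Together with [F0] itself, the surviving tops are all the faces of [B]. *)
have F0low : F0 \in low_faces W J F0 f.
  by rewrite in_low F0face; apply/forall_inP => i; rewrite setDv inE.
rewrite (bigD1 F0) //= (pointed_rk0 pt) expr0.
rewrite (partition_big top good) => [/=|F /andP[]]; last exact: top_good.
rewrite (eq_bigr (fun T => if T \subset B then (-1) ^+ rk W T else 0)); last first.
  by move=> T /inner <-; apply: eq_bigl => F; rewrite andbA.
rewrite -big_mkcondr /=.
have hF : - h \in W by rewrite memvN.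
have := IH _ _ _ _ rkB (pointed_face pt Bface) hF.
have -> : nonneg_on B (- h) = false.
  apply/negP => /forall_inP/(_ imu); rewrite memB imuJ fmu eqxx => /(_ isT).
  by rewrite ffunE oppr_ge0 leNgt hpos.
rewrite (bigD1 F0) /=; last first.
  rewrite in_low (pointed_face pt Bface).2; apply/forall_inP => i.
  by rewrite setDv inE.
rewrite (pointed_rk0 pt) expr0 => eq0; rewrite -[RHS]eq0; congr (_ + _).
apply: eq_bigl => T; rewrite /good /= [in RHS]in_low (cone_faces_face _ Bface).
rewrite [T \in low_faces _ _ _ _]in_low.
case: (boolP (T \in cone_faces W J)) => //= Tface.
rewrite andbC; case: (boolP (T \subset B)) => //= /subsetP TB.
have Tneg i : i \in T :\: F0 -> f i = mu * h i /\ 0 < h i.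
  move=> /setDP[/TB]; rewrite memB => /andP[iJ /eqP fi] iF0.
  by rewrite hpos.
have -> : [forall i in T :\: F0, f i < 0].
  by apply/forall_inP => i /Tneg[-> hi]; rewrite pmulr_llt0.
have -> : [forall i in T :\: F0, (- h) i < 0].
  by apply/forall_inP => i /Tneg[_ hi]; rewrite ffunE oppr_lt0.
have -> : top T == T.
  rewrite eqEsubset top_sub; apply/subsetP => i iT; rewrite inE iT /=.
  case: (boolP (i \in F0)) => //= iF0; apply/forall_inP => k kT.
  have [fk hk] := Tneg _ kT; have [|fi hi] := Tneg i; first exact/setDP.
  by rewrite /ratio fk fi !mulfK ?gt_eqF.
by rewrite andbT.
Qed.

(** If [f] is a negative multiple of [h] then all faces are low, and [f] may be replaced
    by any negative function that is not proportional to [h]. Such a function exists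
    unless the rank is one, where [F0] and [J] are the only faces. *)
Lemma euler_low W J F0 f : pointed W J F0 -> f \in W ->
  \sum_(F in low_faces W J F0 f) (-1) ^+ rk W F = (nonneg_on J f)%:R :> int.
Proof.
have [n] := ubnP (rk W J); elim: n W J F0 f => // n IHn W J F0 f rkJ pt fW.
have IH W' J' F' f' : (rk W' J' < rk W J)%N -> pointed W' J' F' -> f' \in W' ->
    \sum_(F in low_faces W' J' F' f') (-1) ^+ rk W' F = (nonneg_on J' f')%:R :> int.
  by move=> lt; apply: IHn; apply: leq_trans lt _.
have [W0 F0face] := pt; have /cone_facesP[h hW [h0 eqF0]] := F0face.
have hpos i : i \in J -> i \notin F0 -> 0 < h i.
  by move=> iJ; rewrite eqF0 inE iJ /= => hi; rewrite lt_def hi h0.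
have hF0 i : i \in F0 -> h i = 0 by rewrite eqF0 inE => /andP[_ /eqP].
case: (boolP (nonneg_on J f)) => [/forall_inP fge|].
  rewrite (big_pred1 F0) ?(pointed_rk0 pt) // => F; rewrite in_low /=.
  apply/andP/eqP => [[Fface /forall_inP Fneg]|->]; last first.
    by split=> //; apply/forall_inP => i; rewrite setDv inE.
  apply/eqP; rewrite eqEsubset (pointed_min pt) // andbT.
  rewrite -setD_eq0; apply/negPn/negP => /set0Pn[i iF].
  have := Fneg _ iF; rewrite ltNge fge //.
  by move: iF => /setDP[/(subsetP (cone_face_sub Fface))].
rewrite negb_forall_in => /exists_inP[i0 i0J]; rewrite -ltNge => f_neg.
have neg : exists2 i, i \in J & f i < 0 by exists i0.
have i0F0 : i0 \notin F0.
  by apply: contraTN f_neg => /(vanishP _ _ (subvP W0 _ fW)) ->; rewrite ltxx.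
pose nonprop (g : vecs) := forall mu : R, exists2 i, i \in J & g i != mu * h i.
case: (pselect (nonprop f)) => [|/existsNP[mu fmu]].
  exact: (euler_low_step IH hW h0 eqF0 W0 fW neg).
have {}fmu i : i \in J -> f i = mu * h i.
  by move=> iJ; apply/eqP/negPn/negP => fi; apply: fmu; exists i.
have mu0 : mu < 0.
  by rewrite -(pmulr_llt0 _ (hpos _ i0J i0F0)) -fmu.
have low_all (g : vecs) : (forall i, i \in J -> i \notin F0 -> g i < 0) ->
    low_faces W J F0 g = cone_faces W J.
  move=> gneg; apply/setP => F; rewrite in_low.
  case: (boolP (F \in _)) => //= /cone_face_sub/subsetP FJ.
  by apply/forall_inP => i /setDP[/FJ]; apply: gneg.
rewrite (low_all f) => [|i iJ iF0]; last by rewrite fmu // pmulr_llt0 ?hpos.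
(* [g - k *: h] is negative for large [k], and as little proportional to [h] as [g]. *)
case: (pselect (exists2 g, g \in W & nonprop g)) => [[g gW gnp]|allprop].
  have [|k kP] := @dominate (J :\: F0) (- g) h.
    by move=> i /setDP[]; apply: hpos.
  have neg' i : i \in J -> i \notin F0 -> (g - k *: h) i < 0.
    move=> iJ iF0; have := kP i; rewrite !ffunE subr_gt0 subr_lt0.
    by apply; apply/setDP.
  rewrite -(low_all _ neg'); apply: (euler_low_step IH hW h0 eqF0 W0) => //.
  - by rewrite memvB ?memvZ.
  - by exists i0 => //; apply: neg'.
  move=> nu; have [i iJ gi] := gnp (k + nu); exists i => //.
  apply: contra gi; rewrite !ffunE mulrDl => /eqP <-; apply/eqP.
  by rewrite addrC subrK.
have prop (g : vecs) : g \in W -> exists nu : R, {in J, forall i, g i = nu * h i}.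
  move=> gW; apply: contrapT => np; apply: allprop; exists g => // nu.
  apply: contrapT => np'; apply: np; exists nu => i iJ.
  by apply/eqP/negPn/negP => gi; apply: np'; exists i.
have F0J : F0 != J by apply: contraNneq i0F0 => ->.
have rk1 : rk W J = 1%N.
  apply/eqP; rewrite eqn_leq; apply/andP; split; last first.
    rewrite -(pointed_rk0 pt).
    exact: (cone_face_rk_lt F0face (cone_face_sub F0face) (subxx _) F0J).
  rewrite (@rk_closure _ _ W [set i0] J) ?sub1set //; last first.
    move=> y /prop[nu yE] /vanishP/(_ i0 (set11 _)); rewrite yE // => /eqP.
    rewrite mulf_eq0 (gt_eqF (hpos _ i0J i0F0)) orbF => /eqP nu0.
    by apply/vanishP => i iJ; rewrite yE // nu0 mul0r.
  by rewrite -(cards1 i0) rk_card.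
rewrite (bigD1 F0) //= (big_pred1 J) ?rk1 ?(pointed_rk0 pt) // => F /=.
apply/andP/eqP => [[/cone_facesP[y yW [y0 ->]]]|->]; last first.
  by rewrite cone_face_full eq_sym.
have [nu yE] := prop _ yW; apply: contraNeq => neqJ.
have nu0 : nu != 0.
  apply: contraNneq neqJ => nu0; apply/eqP/setP => i; rewrite mem_zeros.
  by case: (boolP (i \in J)) => //= iJ; rewrite yE // nu0 mul0r eqxx.
apply/eqP/setP => i; rewrite eqF0 !mem_zeros.
by case: (boolP (i \in J)) => //= iJ; rewrite yE // mulf_eq0 (negbTE nu0).
Qed.

Theorem euler_cone W J F0 : pointed W J F0 -> F0 != J ->
  \sum_(F in cone_faces W J) (-1) ^+ rk W F = 0 :> int.
Proof.
move=> pt F0J; have [W0 F0face] := pt.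
have /cone_facesP[h hW [h0 eqF0]] := F0face.
have hpos i : i \in J -> i \notin F0 -> 0 < h i.
  by move=> iJ; rewrite eqF0 inE iJ /= => hi; rewrite lt_def hi h0.
have -> : cone_faces W J = low_faces W J F0 (- h).
  apply/setP => F; rewrite in_low.
  case: (boolP (F \in _)) => //= /cone_face_sub/subsetP FJ.
  apply/esym/forall_inP => i /setDP[/FJ iJ iF0].
  by rewrite ffunE oppr_lt0 hpos.
rewrite (euler_low pt) ?memvN //.
suff -> : nonneg_on J (- h) = false by [].
have [i /setDP[iJ iF0]] : exists i, i \in J :\: F0.
  apply/set0Pn; apply: contra F0J; rewrite setD_eq0 eqEsubset => ->.
  by rewrite (cone_face_sub F0face).
apply/negP => /forall_inP/(_ i iJ).
by rewrite ffunE oppr_ge0 leNgt hpos.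
Qed.

Definition rk_faces W J r := [set F in cone_faces W J | rk W F == r].

Lemma in_rk_faces W J r F :
  (F \in rk_faces W J r) = (F \in cone_faces W J) && (rk W F == r).
Proof. by rewrite in_set. Qed.

Lemma rk_faces0 W J F0 : pointed W J F0 -> rk_faces W J 0%N = [set F0].
Proof.
move=> pt; apply/setP => F; rewrite in_rk_faces in_set1.
apply/andP/eqP => [[Fface /eqP rkF]|->]; last first.
  by rewrite (pointed_rk0 pt); split=> //; have [] := pt.
apply/eqP; apply: contraTT isT; rewrite eq_sym => neq.
have := cone_face_rk_lt pt.2 (pointed_min pt Fface) (cone_face_sub Fface) neq.
by rewrite rkF.
Qed.

Lemma rk_faces_max W J : rk_faces W J (rk W J) = [set J].
Proof.
apply/setP => F; rewrite in_rk_faces in_set1.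
apply/andP/eqP => [[Fface /eqP rkF]|->]; last by rewrite cone_face_full.
apply/eqP; apply: contraTT isT => neq.
have := cone_face_rk_lt Fface (cone_face_sub Fface) (subxx _) neq.
by rewrite rkF ltnn.
Qed.

Lemma euler_rk_faces W J F0 : pointed W J F0 -> F0 != J ->
  \sum_(r < (rk W J).+1) (-1) ^+ r * #|rk_faces W J r|%:R = 0 :> int.
Proof.
move=> pt F0J; rewrite -[RHS](euler_cone pt F0J).
rewrite (partition_big (fun F => inord (rk W F) : 'I_(rk W J).+1) xpredT) //=.
apply: eq_bigr => r _; rewrite (eq_bigl (fun F => F \in rk_faces W J r)).
  rewrite (eq_bigr (fun=> (-1) ^+ r)); last first.
    by move=> F; rewrite in_rk_faces => /andP[_ /eqP ->].
  by rewrite sumr_const mulr_natr.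
move=> F; rewrite in_rk_faces; case: (boolP (F \in _)) => //= Fface.
by rewrite -val_eqE /= inordK // ltnS rk_subset // (cone_face_sub Fface).
Qed.

Lemma pointed_rk_gt0 W J F0 : pointed W J F0 -> (F0 != J) = (0 < rk W J)%N.
Proof.
move=> pt; apply/idP/idP => [neq|]; last first.
  by apply: contraTneq => <-; rewrite (pointed_rk0 pt).
rewrite -(pointed_rk0 pt).
exact: (cone_face_rk_lt pt.2 (cone_face_sub pt.2) (subxx _) neq).
Qed.

(** A segment has two ends. *)
Lemma rk2_atoms W J F0 :
  pointed W J F0 -> rk W J = 2%N -> #|rk_faces W J 1%N| = 2%N.
Proof.
move=> pt rk2; have := euler_rk_faces pt; rewrite (pointed_rk_gt0 pt) rk2.
move=> /(_ isT); rewrite !big_ord_recr big_ord0 /= (rk_faces0 pt) cards1.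
have -> : rk_faces W J 2%N = [set J] by rewrite -(rk_faces_max W J) rk2.
rewrite cards1 !exprS expr0 !mulN1r !opprK !mul1r; lia.
Qed.

(** Euler's relation for 4-polytopes: ranks exceed dimensions by one. *)
Lemma euler_rk5 W J F0 : pointed W J F0 -> rk W J = 5%N ->
  (#|rk_faces W J 1%N| + #|rk_faces W J 3%N| =
   #|rk_faces W J 2%N| + #|rk_faces W J 4%N|)%N.
Proof.
move=> pt rk5; have := euler_rk_faces pt; rewrite (pointed_rk_gt0 pt) rk5.
move=> /(_ isT); rewrite !big_ord_recr big_ord0 /= (rk_faces0 pt) cards1.
have -> : rk_faces W J 5%N = [set J] by rewrite -(rk_faces_max W J) rk5.
rewrite cards1 !exprS expr0 !mulN1r !opprK !mul1r; lia.
Qed.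

(** As the rank exceeds one, some [f] is not proportional to [h]. The faces on which the
    ratio [f / h] is least and on which it is largest meet in [F0] only, so one of them
    avoids [a]. *)
Lemma avoiding_face W J F0 a : pointed W J F0 -> (1 < rk W J)%N ->
    a \in J :\: F0 ->
  exists2 F, F \in cone_faces W J & (F != F0) && (a \notin F).
Proof.
move=> pt rk2 /setDP[aJ aF0]; have [W0 F0face] := pt.
have /cone_facesP[h hW [h0 eqF0]] := F0face.
have hpos i : i \in J -> i \notin F0 -> 0 < h i.
  by move=> iJ; rewrite eqF0 inE iJ /= => hi; rewrite lt_def hi h0.
have ha := hpos _ aJ aF0.
have [f fW fnp] : exists2 f, f \in W & ~ exists mu : R, {in J, forall i, f i = mu * h i}.
  apply: contrapT => np; move: rk2; rewrite ltnNge => /negP; apply.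
  rewrite (@rk_closure _ _ W [set a] J) ?sub1set //.
    by rewrite -(cards1 a) rk_card.
  move=> y yW /vanishP/(_ a (set11 _)) ya.
  apply/vanishP => i iJ; apply: contrapT => yi; apply: np; exists y => //.
  move=> [mu yE]; apply: yi; move: ya; rewrite !yE // => /eqP.
  by rewrite mulf_eq0 (gt_eqF ha) orbF => /eqP ->; rewrite mul0r.
have F0J : F0 != J by apply: contraNneq aF0 => ->.
have [mu [lemu Bface [i /setDP[iJ iF0] fi]]] := bottom_face hW fW h0 eqF0 W0 F0J.
have fW' : - f \in W by rewrite memvN.
have [nu [lenu Cface [k /setDP[kJ kF0] fk]]] := bottom_face hW fW' h0 eqF0 W0 F0J.
case: (boolP (a \in zeros J (f - mu *: h))) => aB; last first.
  exists (zeros J (f - mu *: h)) => //; rewrite aB andbT.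
  apply: contraNneq iF0 => <-.
  by rewrite mem_zeros iJ !ffunE subr_eq0 fi eqxx.
exists (zeros J (- f - nu *: h)) => //; apply/andP; split.
  apply: contraNneq kF0 => <-.
  by rewrite mem_zeros kJ !ffunE subr_eq0 /=; move: fk; rewrite ffunE => ->.
move: aB; rewrite !mem_zeros aJ !ffunE !subr_eq0 /= => /eqP fa.
apply/negP => /eqP fa'; apply: fnp; exists mu => b bJ.
apply/le_anti; rewrite lemu // andbT.
have eqnu : mu = - nu.
  apply: (mulIf (lt0r_neq0 ha)); rewrite mulNr.
  by apply: oppr_inj; rewrite opprK; move: fa fa'; rewrite /GRing.scale /= => <- <-.
by have := lenu b bJ; rewrite ffunE eqnu mulNr lerNr.
Qed.

(** A face avoiding [a] can be enlarged inside its face figure until its corank is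
    one. *)
Lemma avoiding_coatom W J F0 a : pointed W J F0 -> a \in J :\: F0 ->
  exists2 G, G \in rk_faces W J (rk W J).-1 & a \notin G.
Proof.
have [n] := ubnP (rk W J); elim: n W F0 => // n IHn W F0 rkJ pt /[dup] aJF0 /setDP[aJ aF0].
have rk_gt0 : (0 < rk W J)%N.
  by rewrite -(pointed_rk_gt0 pt); apply: contraNneq aF0 => ->.
case: (ltnP 1 (rk W J)) => [rk_gt1|rk_le1]; last first.
  exists F0 => //; rewrite in_rk_faces pt.2 (pointed_rk0 pt) /=; lia.
have [F Fface /andP[FF0 aF]] := avoiding_face pt rk_gt1 aJF0.
have rkF : (0 < rk W F)%N.
  by rewrite -(pointed_rk_gt0 (pointed_face pt Fface)) eq_sym.
have eqrk := rk_link W (cone_face_sub Fface).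
have [||G] := IHn (W :&: vanish F)%VS F _ (pointed_link Fface).
- by rewrite -ltnS; apply: leq_trans rkJ; rewrite eqrk ltnS -[X in (X < _)%N]add0n ltn_add2r.
- exact/setDP.
rewrite in_rk_faces (cone_faces_link _ Fface) => /andP[/andP[Gface FG] /eqP rkG] aG.
exists G => //; rewrite in_rk_faces Gface (rk_link W FG) rkG eqrk /=.
have : (0 < rk (W :&: vanish F)%VS J)%N.
  by rewrite -(pointed_rk_gt0 (pointed_link Fface)); apply: contraNneq aF => ->.
lia.
Qed.

Lemma coatom_above W J F0 F : pointed W J F0 -> F \in cone_faces W J -> F != J ->
  exists2 G, G \in rk_faces W J (rk W J).-1 & F \subset G.
Proof.
move=> pt Fface FJ; have ptF := pointed_link Fface.
have [a aJ] : exists a, a \in J :\: F.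
  apply/set0Pn; apply: contra FJ; rewrite setD_eq0 eqEsubset => ->.
  by rewrite (cone_face_sub Fface).
have [G] := avoiding_coatom ptF aJ.
rewrite in_rk_faces (cone_faces_link _ Fface) => /andP[/andP[Gface FG] /eqP rkG] _.
exists G => //; rewrite in_rk_faces Gface (rk_link W FG) rkG.
rewrite (rk_link W (cone_face_sub Fface)) /=.
have : (0 < rk (W :&: vanish F)%VS J)%N by rewrite -(pointed_rk_gt0 ptF).
lia.
Qed.

Lemma atom_exists W J F0 : pointed W J F0 -> F0 != J ->
  exists A, A \in rk_faces W J 1%N.
Proof.
have [n] := ubnP (rk W J); elim: n J => // n IHn J rkJ pt F0J.
have rk_gt0 : (0 < rk W J)%N by rewrite -(pointed_rk_gt0 pt).
case: (ltnP 1 (rk W J)) => [rk_gt1|rk_le1]; last first.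
  by exists J; rewrite in_rk_faces cone_face_full /= eqn_leq rk_le1 rk_gt0.
have [a aJ] : exists a, a \in J :\: F0.
  apply/set0Pn; apply: contra F0J; rewrite setD_eq0 eqEsubset => ->.
  by rewrite (cone_face_sub pt.2).
have [F Fface /andP[FF0 aF]] := avoiding_face pt rk_gt1 aJ.
have [||A] := IHn F _ (pointed_face pt Fface).
- rewrite -ltnS; apply: leq_trans rkJ; rewrite ltnS.
  apply: (cone_face_rk_lt Fface (cone_face_sub Fface) (subxx _)).
  by apply: contraNneq aF => ->; move: aJ => /setDP[].
- by rewrite eq_sym.
rewrite in_rk_faces (cone_faces_face _ Fface) => /andP[/andP[Aface _] rkA].
by exists A; rewrite in_rk_faces Aface.
Qed.

(** A polytope of dimension [d] has at least [d.+1] facets: by induction at least [d]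
    facets contain a given vertex, since they are the facets of its vertex figure, and some
    facet avoids the vertex. *)
Lemma leq_rk_coatoms W J F0 : pointed W J F0 ->
  (rk W J <= #|rk_faces W J (rk W J).-1|)%N.
Proof.
have [n] := ubnP (rk W J); elim: n W F0 => // n IHn W F0 rkJ pt.
case: (ltnP 1 (rk W J)) => [rk_gt1|]; last first.
  case: (posnP (rk W J)) => [-> //|rk_gt0 rk_le1].
  have -> : rk W J = 1%N by apply/eqP; rewrite eqn_leq rk_le1.
  by rewrite (rk_faces0 pt) cards1.
have rk_gt0 : (0 < rk W J)%N by apply: ltnW.
have F0J : F0 != J by rewrite (pointed_rk_gt0 pt).
have [A] := atom_exists pt F0J; rewrite in_rk_faces => /andP[Aface /eqP rkA].
have eqrk := rk_link W (cone_face_sub Aface).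
have ptA := pointed_link Aface.
have lt : (rk (W :&: vanish A) J < n)%N.
  by rewrite -ltnS; apply: leq_trans rkJ; rewrite eqrk rkA.
have [a aA] : exists a, a \in A :\: F0.
  apply/set0Pn; apply/negP; rewrite setD_eq0 => AF0.
  by have := rk_subset W AF0; rewrite rkA (pointed_rk0 pt).
have [G Gco aG] : exists2 G, G \in rk_faces W J (rk W J).-1 & a \notin G.
  apply: avoiding_coatom pt _; apply: subsetP aA.
  exact/setSD/(cone_face_sub Aface).
have sub : rk_faces (W :&: vanish A) J (rk (W :&: vanish A) J).-1
    \subset rk_faces W J (rk W J).-1 :\ G.
  apply/subsetP => F; rewrite in_rk_faces (cone_faces_link _ Aface) in_setD1.
  move=> /andP[/andP[Fface AF] /eqP rkF]; apply/andP; split.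
    apply: contraNneq aG => <-; apply: (subsetP AF).
    by move: aA => /setDP[].
  rewrite in_rk_faces Fface (rk_link W AF) rkF eqrk rkA /=.
  by move: rk_gt1; rewrite eqrk rkA; case: (rk (W :&: _) J).
have le := leq_trans (IHn _ _ lt (pointed_link Aface)) (subset_leq_card sub).
by rewrite (cardsD1 G (rk_faces W J _)) Gco [X in (X <= _)%N]eqrk rkA.
Qed.

(** * Face numbers of four-dimensional polytopes *)

(** The face figure of a face of corank two is a segment, and its ends are the coatoms
    above that face. *)
Lemma corank2_coatoms W J F0 F : pointed W J F0 -> F \in cone_faces W J ->
    rk W J = (rk W F).+2 ->
  #|[set G in rk_faces W J (rk W F).+1 | F \subset G]| = 2%N.
Proof.
move=> pt Fface rkJ; have eqrk := rk_link W (cone_face_sub Fface).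
have rk2 : rk (W :&: vanish F) J = 2%N.
  by apply: (@addnI (rk W F)); rewrite -eqrk rkJ addn2.
rewrite -(rk2_atoms (pointed_link Fface) rk2); apply: eq_card => G.
rewrite in_set !in_rk_faces (cone_faces_link _ Fface).
case: (boolP (G \in _)) => //= Gface; case: (boolP (F \subset G)) => FG.
  by rewrite andbT (rk_link W FG) -addn1 eqn_add2l.
by rewrite andbF.
Qed.

(** Counts the incident pairs of a face of corank two and a facet. *)
Lemma double_count_corank2 W J F0 r : pointed W J F0 -> rk W J = r.+2 ->
  (2 * #|rk_faces W J r| = \sum_(G in rk_faces W J r.+1) #|rk_faces W G r|)%N.
Proof.
move=> pt rkJ.
transitivity (\sum_(F in rk_faces W J r)
   #|[set G in rk_faces W J r.+1 | F \subset G]|)%N.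
  rewrite mulnC -sum_nat_const; apply: eq_bigr => F.
  rewrite in_rk_faces => /andP[Fface /eqP rkF].
  by rewrite -rkF (corank2_coatoms pt Fface) ?rkF.
rewrite (eq_bigr (fun F => \sum_(G in rk_faces W J r.+1 | F \subset G) 1))%N; last first.
  by move=> F _; rewrite -sum1_card; apply: eq_bigl => G; rewrite in_set.
rewrite (exchange_big_dep (mem (rk_faces W J r.+1))) /=; last by move=> F G _ /andP[].
apply: eq_bigr => G Gco; rewrite -sum1_card; apply: eq_bigl => F.
rewrite Gco /=; move: Gco; rewrite !in_rk_faces => /andP[Gface _].
by rewrite (cone_faces_face _ Gface) andbAC.
Qed.

(** An edge has two ends and is determined by them: if two edges share both ends, their
    intersection is a face of rank two. *)
Lemma edges_leq_bin W J F0 : pointed W J F0 ->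
  (#|rk_faces W J 2%N| <= 'C(#|rk_faces W J 1%N|, 2))%N.
Proof.
move=> pt; rewrite -cards_draws.
pose ends E := rk_faces W E 1%N.
have endsP E A : E \in rk_faces W J 2%N ->
    (A \in ends E) = (A \in rk_faces W J 1%N) && (A \subset E).
  rewrite in_rk_faces => /andP[Eface _].
  by rewrite !in_rk_faces (cone_faces_face _ Eface) andbAC.
rewrite -(card_in_imset (f := ends)).
  apply/subset_leq_card/subsetP => _ /imsetP[E E2 ->]; rewrite inE.
  apply/andP; split.
    by apply/subsetP => A; rewrite (endsP _ _ E2) => /andP[].
  move: E2; rewrite in_rk_faces => /andP[Eface /eqP rkE2].
  by rewrite (rk2_atoms (pointed_face pt Eface) rkE2).
move=> E E' E2 E2' eqends.
have cap_eq : E :&: E' = E.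
  move: (E2) (E2'); rewrite !in_rk_faces => /andP[Eface /eqP rkE2] /andP[Eface' _].
  have capface := cone_face_cap Eface Eface'.
  apply/eqP; apply: contraT => neq.
  have := cone_face_rk_lt capface (subsetIl _ _) (cone_face_sub Eface) neq.
  rewrite rkE2 ltnS => rkcap.
  have /eqP := rk2_atoms (pointed_face pt Eface) rkE2.
  suff /subset_leq_card : ends E \subset [set E :&: E'].
    by rewrite cards1 => le1 /eqP eq2; rewrite -/(ends E) eq2 in le1.
  apply/subsetP => A AE; have AE' : A \in ends E' by rewrite -eqends.
  move: AE AE'; rewrite (endsP _ _ E2) (endsP _ _ E2') in_rk_faces.
  move=> /andP[/andP[Aface /eqP rkA] AE] /andP[_ AE'].
  rewrite in_set1; apply: contraT => neqA.
  have Acap : A \subset E :&: E' by rewrite subsetI AE.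
  have := cone_face_rk_lt Aface Acap (cone_face_sub capface) neqA.
  by rewrite rkA ltnNge rkcap.
move: (E2) (E2'); rewrite !in_rk_faces => /andP[Eface /eqP rkE2] /andP[Eface' /eqP rkE2'].
apply/eqP; rewrite -cap_eq; apply: contraT => neq.
have := cone_face_rk_lt (cone_face_cap Eface Eface') (subsetIr _ _) (cone_face_sub Eface') neq.
by rewrite cap_eq rkE2 rkE2'.
Qed.

(** A 3-dimensional facet has at least four 2-faces, and a 2-face lies in two facets, so
    [2 * f_3 <= f_2]. Euler's relation then bounds [f_1 - f_0] from below by [f_2 / 2],
    rounded up. *)
Lemma rk5_bounds W J F0 : pointed W J F0 -> rk W J = 5%N ->
  (#|rk_faces W J 1%N| + uphalf #|rk_faces W J 3%N| <= #|rk_faces W J 2%N| <=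
     'C(#|rk_faces W J 1%N|, 2))%N.
Proof.
move=> pt rk5; rewrite (edges_leq_bin pt) andbT.
have eu := euler_rk5 pt rk5; have dc := double_count_corank2 pt rk5.
have le : (4 * #|rk_faces W J 4%N| <= 2 * #|rk_faces W J 3%N|)%N.
  rewrite dc mulnC -sum_nat_const; apply: leq_sum => G.
  rewrite in_rk_faces => /andP[Gface /eqP rkG].
  by have := leq_rk_coatoms (pointed_face pt Gface); rewrite rkG.
move: le eu; move: #|_| #|_| #|_| #|_| => d c a b; lia.
Qed.

(** If the facets are simplices, then [2 * f_3 = f_2] and the bound above is an
    equality. *)
Lemma rk5_simplicial W J F0 : pointed W J F0 -> rk W J = 5%N ->
    {in rk_faces W J 4%N, forall G, #|G| = 4%N} ->
  #|rk_faces W J 3%N| = (2 * (#|rk_faces W J 2%N| - #|rk_faces W J 1%N|))%N.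
Proof.
move=> pt rk5 simp.
have eu := euler_rk5 pt rk5; have dc := double_count_corank2 pt rk5.
have le : (4 * #|rk_faces W J 4%N| = 2 * #|rk_faces W J 3%N|)%N.
  rewrite dc mulnC -sum_nat_const; apply: eq_bigr => G G4.
  have cardG := simp _ G4.
  move: (G4); rewrite in_rk_faces => /andP[Gface /eqP rkG].
  apply/anti_leq/andP; split.
    by have := leq_rk_coatoms (pointed_face pt Gface); rewrite rkG.
  have -> : 4%N = 'C(#|G|, 3) by rewrite cardG.
  rewrite -cards_draws; apply/subset_leq_card/subsetP => F.
  rewrite in_rk_faces => /andP[Fface /eqP rkF].
  rewrite in_set (cone_face_sub Fface) eqn_leq -{2}rkF rk_card andbT -ltnS -cardG.
  rewrite proper_card // properEneq (cone_face_sub Fface) andbT.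
  by apply: contra_eq_neq rkF => ->; rewrite rkG.
move: le eu; move: #|_| #|_| #|_| #|_| => d c a b; lia.
Qed.

Lemma rk_faces1_card W J F0 : pointed W J F0 -> F0 = set0 ->
    {in J, forall i, [set i] \in cone_faces W J} ->
  #|rk_faces W J 1%N| = #|J|.
Proof.
move=> pt F00 single.
have rk_single i : i \in J -> rk W [set i] = 1%N.
  move=> iJ; apply/anti_leq; rewrite -{1}(cards1 i) rk_card /=.
  rewrite -(pointed_rk_gt0 (pointed_face pt (single i iJ))) F00 eq_sym.
  by apply/set0Pn; exists i; rewrite set11.
rewrite -(card_imset _ (@set1_inj I)); apply: eq_card => A.
rewrite in_rk_faces; apply/andP/imsetP => [[Aface /eqP rkA]|[i iJ ->]]; last first.
  by rewrite single // rk_single.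
have [i iA] : exists i, i \in A.
  by apply/set0Pn; apply: contra_eq_neq rkA => ->; rewrite rk_set0.
have iJ := subsetP (cone_face_sub Aface) _ iA.
exists i => //; apply/eqP; rewrite eq_sym; apply: contraT => neq.
have iA' : [set i] \subset A by rewrite sub1set.
have := cone_face_rk_lt (single i iJ) iA' (cone_face_sub Aface) neq.
by rewrite rkA rk_single.
Qed.

End Cone.

(** * Slack vectors of a point configuration *)

Section Slack.
Variables (R : realFieldType) (I : finType) (m : nat) (v : I -> 'rV[R]_m).
Local Notation vecs := {ffun I -> R^o}.
Local Notation vanish := (vanish R).
Implicit Types (Z : {set I}) (c : 'cV[R]_m) (b : R).

Definition slack c b : vecs := [ffun i => b - (v i *m c) 0 0].

Definition slack_pair (p : 'cV[R]_m * R^o) : vecs := slack p.1 p.2.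

Fact slack_is_linear : linear slack_pair.
Proof.
move=> a [c b] [c' b']; apply/ffunP => i; rewrite !ffunE /=.
rewrite mulmxDr -scalemxAr !mxE /GRing.scale /=; ring.
Qed.

HB.instance Definition _ :=
  GRing.isLinear.Build R ('cV[R]_m * R^o)%type vecs _ slack_pair slack_is_linear.

Definition slack_space : {vspace vecs} := limg (linfun slack_pair).

Lemma slack_spaceP (y : vecs) :
  reflect (exists c b, y = slack c b) (y \in slack_space).
Proof.
apply: (iffP memv_imgP) => [[[c b] _ ->]|[c [b ->]]].
  by exists c, b; rewrite lfunE.
by exists (c, b); rewrite ?memvf ?lfunE.
Qed.

Lemma slack_mem c b : slack c b \in slack_space.
Proof. by apply/slack_spaceP; exists c, b. Qed.

(** A coordinate of the projection along [U]. *)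
Lemma separating_covector (U : {vspace 'rV[R]_m}) x : x \notin U ->
  exists2 c : 'cV[R]_m, {in U, forall u : 'rV[R]_m, (u *m c) 0 0 = 0} &
                        (x *m c) 0 0 != 0.
Proof.
pose f : 'End('rV[R]_m) := (\1 - projv U)%VF => xU.
have fE u : f u = u - projv U u by rewrite !lfun_simp.
have [j fj] : exists j, f x 0 j != 0.
  apply: contrapT => np; move: xU; apply/negP; rewrite negbK.
  have <- : projv U x = x; last exact: memv_proj.
  apply/esym/eqP; rewrite -subr_eq0 -fE; apply/eqP/rowP => j; rewrite mxE.
  by apply/eqP; apply: contrapT => /negP fj; apply: np; exists j.
have cE u : (u *m col j (lin1_mx f)) 0 0 = f u 0 j.
  by rewrite -[in RHS](mul_rV_lin1 f) !mxE; apply: eq_bigr => k _; rewrite !mxE.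
exists (col j (lin1_mx f)) => [u uU|]; last by rewrite cE.
by rewrite cE fE projv_id // subrr mxE.
Qed.

Definition direction_space i0 Z : {vspace 'rV[R]_m} := (\sum_(i in Z) <[v i - v i0]>)%VS.

Lemma vanish_direction_space i0 Z c b : i0 \in Z ->
  (slack c b \in vanish Z) =
  [&& slack c b i0 == 0 &
      `[< {in direction_space i0 Z, forall u : 'rV[R]_m, (u *m c) 0 0 = 0} >]].
Proof.
move=> i0Z; apply/vanishP/andP => [y0|[/eqP y0 /asboolP cU] i iZ].
  split; first by rewrite y0.
  apply/asboolP => _ /memv_sumP[us usP ->].
  rewrite mulmx_suml summxE big1 // => i iZ.
  have /vlineP[k ->] := usP _ iZ; rewrite -scalemxAl mulmxBl !mxE.
  have := y0 _ iZ; have := y0 _ i0Z; rewrite !ffunE !mxE => e0 e.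
  by rewrite (_ : _ - _ = 0) ?mulr0 //; lra.
have : ((v i - v i0) *m c) 0 0 = 0.
  by apply/cU/(subvP (sumv_sup i iZ (subvv _)))/memv_line.
rewrite mulmxBl !mxE; move: y0; rewrite !ffunE !mxE; lra.
Qed.

Lemma direction_space_setU1 i0 Z i :
  direction_space i0 (i |: Z) = (<[v i - v i0]> + direction_space i0 Z)%VS.
Proof.
rewrite /direction_space; case: (boolP (i \in Z)) => iZ; last by rewrite big_setU1.
rewrite (setUidPr _) ?sub1set //; apply/esym/addv_idPr.
exact: (sumv_sup i).
Qed.

(** When a point is added, both sides grow by one or both stay the same, according to
    whether the point lies outside the affine hull of the other points; a separating
    covector makes the rank grow. *)
Lemma rk_slack i0 Z : i0 \in Z -> rk slack_space Z = (\dim (direction_space i0 Z)).+1.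
Proof.
have [n] := ubnP #|Z|; elim: n Z => // n IHn Z ltn i0Z.
have [Z1|[i]] := set_0Vmem (Z :\ i0).
  have -> : Z = [set i0] by rewrite -(setD1K i0Z) Z1 setU0.
  rewrite /direction_space big_set1 subrr (_ : <[0]>%VS = 0%VS) ?dimv0; last first.
    by apply/eqP; rewrite -dimv_eq0 dim_vline eqxx.
  apply/anti_leq; rewrite -{1}(cards1 i0) rk_card /= -[X in (X <= _)%N]/(0.+1).
  rewrite -(rk_set0 slack_space); apply: (@rk_ltn _ _ _ _ _ (slack 0 1)).
  - exact: sub0set.
  - exact: slack_mem.
  - by apply/vanishP => k; rewrite inE.
  - apply/vanishP => /(_ i0 (set11 _)); rewrite ffunE mulmx0 mxE subr0 => /eqP.
    by rewrite oner_eq0.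
move=> /setD1P[ii0 iZ]; rewrite -(setD1K iZ); set Z' := Z :\ i.
have i0Z' : i0 \in Z' by rewrite in_setD1 eq_sym ii0.
have {IHn} IH : rk slack_space Z' = (\dim (direction_space i0 Z')).+1.
  by apply: IHn => //; move: ltn; rewrite (cardsD1 i) iZ.
rewrite direction_space_setU1; case: (boolP (v i - v i0 \in direction_space i0 Z')) => [iU|iU].
  rewrite (addv_idPr _) -?memvE // -IH; apply: rk_closure; first exact: subsetUr.
  move=> _ /slack_spaceP[c [b ->]] sZ'.
  rewrite (vanish_direction_space _ _ (setU1r i i0Z')) direction_space_setU1.
  rewrite (addv_idPr _) -?memvE //.
  by rewrite -vanish_direction_space.
rewrite dimv_disjoint_sum; last first.
  apply/eqP; rewrite -subv0; apply/subvP => x /memv_capP[/vlineP[k ->]].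
  case: (eqVneq k 0) => [-> _|k0 kU]; first by rewrite scale0r mem0v.
  by case/negP: iU; rewrite -[v i - v i0](scalerK k0) memvZ.
have vi0 : v i - v i0 != 0 by apply: contraNneq iU => ->; rewrite mem0v.
rewrite dim_vline vi0 add1n -IH; apply/anti_leq; rewrite rk_setU1 /=.
have [c cU ci] := separating_covector iU.
apply: (@rk_ltn _ _ _ _ _ (slack c ((v i0 *m c) 0 0))).
- exact: subsetUr.
- exact: slack_mem.
- by rewrite (vanish_direction_space _ _ i0Z') ffunE subrr eqxx; apply/asboolP.
apply/vanishP => /(_ i (setU11 _ _)); rewrite ffunE => e; move/eqP: ci; apply.
by rewrite mulmxBl !mxE; move: e; rewrite !mxE; lra.
Qed.

Lemma pointed_slack J : pointed slack_space J set0.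
Proof.
split; first by apply/subvP => y _; apply/vanishP => i; rewrite in_set0.
apply/cone_facesP; exists (slack 0 1); first exact: slack_mem.
have yE i : slack 0 1 i = 1 by rewrite ffunE mulmx0 mxE subr0.
split=> [i _|]; first by rewrite yE.
by apply/setP => i; rewrite mem_zeros yE oner_eq0 in_set0 andbF.
Qed.

End Slack.

(** * The two-fold pyramid over a square *)

Section Pyramid.
Variables (R : realFieldType) (I : finType).
Local Notation vecs := {ffun I -> R^o}.
Local Notation vanish := (vanish R).
Implicit Types (W : {vspace vecs}) (J F : {set I}) (y : vecs).

Lemma rk3_edges W J F0 : pointed W J F0 -> rk W J = 3%N ->
  #|rk_faces W J 2%N| = #|rk_faces W J 1%N|.
Proof.
move=> pt rk3; have := euler_rk_faces pt; rewrite (pointed_rk_gt0 pt) rk3.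
move=> /(_ isT); rewrite !big_ord_recr big_ord0 /= (rk_faces0 pt) cards1.
have -> : rk_faces W J 3%N = [set J] by rewrite -(rk_faces_max W J) rk3.
rewrite cards1 !exprS expr0 !mulN1r !opprK !mul1r; lia.
Qed.

Definition indic (a : I) : vecs := [ffun i => (i == a)%:R].

Variables (W : {vspace vecs}) (a : I).
Hypothesis aW : indic a \in W.

Lemma rk_cone F : a \notin F -> rk W (a |: F) = (rk W F).+1.
Proof.
move=> aF; apply/anti_leq; rewrite rk_setU1 /=.
apply: (rk_ltn (subsetUr _ _) aW).
  by apply/vanishP => i iF; rewrite ffunE; case: eqP iF aF => // -> ->.
apply/vanishP => /(_ a (setU11 _ _)) /eqP.
by rewrite ffunE eqxx oner_eq0.
Qed.

(** Thanks to [indic a] the value at the apex of a function given on the base can be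
    chosen freely. *)
Lemma cone_faces_cone J F : a \notin J ->
  (F \in cone_faces W (a |: J)) = (F :\ a \in cone_faces W J).
Proof.
move=> aJ; apply/idP/idP => /cone_facesP[y yW [y0 eqF]].
  apply/cone_facesP; exists y => //; split=> [i iJ|]; first by apply/y0/setU1r.
  apply/setP => i; rewrite eqF in_setD1 !mem_zeros in_setU1.
  by case: (eqVneq i a) => [->|] //=; rewrite (negbTE aJ).
have eqJ i : i \in J -> (i == a) = false by apply: contraTF => /eqP ->.
apply/cone_facesP; exists (y + ((a \notin F)%:R - y a) *: indic a).
  by rewrite memvD ?memvZ.
have zE i : (y + ((a \notin F)%:R - y a) *: indic a) i =
    if i == a then (a \notin F)%:R else y i.
  rewrite !ffunE /GRing.scale /=; case: eqP => [->|_]; last by rewrite mulr0 addr0.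
  by rewrite mulr1 addrC subrK.
split=> [i|]; first by rewrite zE in_setU1; case: (i == a) => //=; apply: y0.
apply/setP => i; rewrite mem_zeros in_setU1 zE.
have /setP/(_ i) := eqF; rewrite in_setD1 mem_zeros.
case: (eqVneq i a) => [->|] //= _; rewrite pnatr_eq0.
by case: (a \in F).
Qed.

(** The faces of a pyramid are the faces of the base and the cones over them. *)
Lemma rk_faces_cone J r : a \notin J ->
  #|rk_faces W (a |: J) r.+1| = (#|rk_faces W J r.+1| + #|rk_faces W J r|)%N.
Proof.
move=> aJ.
have notin F k : F \in rk_faces W J k -> a \notin F.
  rewrite in_rk_faces => /andP[/cone_face_sub/subsetP sub _].
  by apply: contra aJ; apply: sub.
have -> : rk_faces W (a |: J) r.+1 =
    rk_faces W J r.+1 :|: [set a |: F | F in rk_faces W J r].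
  apply/setP => F; rewrite in_setU in_rk_faces cone_faces_cone //.
  case: (boolP (a \in F)) => aF.
    have rkF : rk W F = (rk W (F :\ a)).+1.
      by rewrite -{1}(setD1K aF) rk_cone // setD11.
    rewrite [F \in rk_faces W J r.+1](contraTF (@notin F r.+1)) //= rkF eqSS.
    apply/andP/imsetP => [[Ff rF]|[G Gr eqG]].
      by exists (F :\ a); rewrite ?setD1K // in_rk_faces Ff.
    by rewrite eqG setU1K ?(notin _ _ Gr) //; move: Gr; rewrite in_rk_faces => /andP[].
  rewrite (setDidPl _) ?disjoints1 1?disjoint_sym ?disjoints1 // in_rk_faces.
  suff /negbTE -> : F \notin [set a |: F | F in rk_faces W J r] by rewrite orbF.
  by apply: contra aF => /imsetP[G _ ->]; rewrite setU11.
rewrite cardsU (_ : _ :&: _ = set0) ?cards0 ?subn0; last first.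
  apply/setP => F; rewrite in_setI in_set0; apply/negP => /andP[/notin aF].
  by move=> /imsetP[G _ eqG]; rewrite eqG setU11 in aF.
congr (_ + _)%N; apply: card_in_imset => F G /notin aF /notin aG eqFG.
by rewrite -(setU1K aF) eqFG setU1K.
Qed.

End Pyramid.

Section SquarePyramid.
Variable R : realFieldType.

Lemma row4_mul_col4 (s t : seq R) :
  ((\row_(j < 4) s`_j) *m (\col_(j < 4) t`_j)) 0 0 =
  s`_0 * t`_0 + s`_1 * t`_1 + s`_2 * t`_2 + s`_3 * t`_3.
Proof. by rewrite mxE !big_ord_recl big_ord0 !mxE /= !addrA addr0. Qed.

(** A square in the plane of the first two coordinates, and an apex on each of the other
    two axes. *)
Definition sqpt (i : bool * bool + bool) : 'rV[R]_4 :=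
  \row_(j < 4) (match i with
    | inl (x, y) => [:: x%:R; y%:R; 0; 0]
    | inr z => [:: 0; 0; (~~ z)%:R; z%:R]
    end)`_j.

Local Notation W := (slack_space sqpt).
Local Notation sqc t := (\col_(j < 4) t`_j).

Definition square : {set bool * bool + bool} := [set inl p | p : bool * bool].

Lemma mem_square p : inl p \in square.
Proof. exact: imset_f. Qed.

Lemma apex_notin_square z : inr z \notin square.
Proof. by apply/imsetP => -[]. Qed.

Lemma square_slack (a b c : R) x y :
  slack sqpt (sqc [:: - a; - b; 0; 0]) c (inl (x, y)) = a * x%:R + b * y%:R + c.
Proof. by rewrite ffunE row4_mul_col4 /=; lra. Qed.

Lemma rk_square : rk W square = 3%N.
Proof.
pose Z1 : {set bool * bool + bool} := [set inl (false, false)].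
pose Z2 := inl (true, false) |: Z1; pose Z3 := inl (false, true) |: Z2.
have sub3 : Z3 \subset square.
  by apply/subsetP => i; rewrite !inE => /or3P[] /eqP ->; apply: mem_square.
have rk3 : rk W square = rk W Z3.
  apply: rk_closure => // _ /slack_spaceP[c [b ->]] /vanishP y0.
  apply/vanishP => _ /imsetP[p _ ->].
  have := y0 (inl (false, false)); have := y0 (inl (false, true)).
  have := y0 (inl (true, false)).
  rewrite !inE !eqxx ?orbT => /(_ isT) + /(_ isT) + /(_ isT).
  rewrite !ffunE !mxE !big_ord_recl !big_ord0 !mxE /=.
  by case: p => -[] [] /=; lra.
apply/anti_leq/andP; split.
  by rewrite rk3; apply: leq_trans (rk_card _ _) _; rewrite !cardsU1 !inE cards1.
have lt1 : (rk W set0 < rk W Z1)%N.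
  apply: (rk_ltn (sub0set _) (slack_mem sqpt (sqc [:: -0; -0; 0; 0]) 1)).
    by apply/vanishP => i; rewrite inE.
  apply/vanishP => /(_ (inl (false, false))); rewrite inE square_slack => /(_ isT) /=.
  lra.
have lt2 : (rk W Z1 < rk W Z2)%N.
  apply: (rk_ltn (subsetUr _ _) (slack_mem sqpt (sqc [:: -1; -0; 0; 0]) 0)).
    by apply/vanishP => i; rewrite !inE => /eqP ->; rewrite square_slack /=; lra.
  apply/vanishP => /(_ (inl (true, false))); rewrite !inE square_slack => /(_ isT) /=.
  lra.
have lt3 : (rk W Z2 < rk W Z3)%N.
  apply: (rk_ltn (subsetUr _ _) (slack_mem sqpt (sqc [:: -0; -1; 0; 0]) 0)).
    by apply/vanishP => i; rewrite !inE => /orP[] /eqP ->; rewrite square_slack /=; lra.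
  apply/vanishP => /(_ (inl (false, true))); rewrite !inE square_slack => /(_ isT) /=.
  lra.
rewrite rk3; lia.
Qed.

Lemma square_vertices : #|rk_faces W square 1%N| = 4%N.
Proof.
transitivity #|square|; last by rewrite card_imset ?card_prod ?card_bool // => p q [].
apply: (rk_faces1_card (pointed_slack sqpt square)) => // _ /imsetP[[x y] _ ->].
pose s (x : bool) : R := if x then -1 else 1.
apply/cone_facesP; exists (slack sqpt (sqc [:: - s x; - s y; 0; 0]) (x%:R + y%:R)).
  exact: slack_mem.
split=> [_ /imsetP[[x' y'] _ ->]|].
  by rewrite square_slack /s; case: x; case: y; case: x'; case: y' => /=; lra.
apply/setP => -[[x' y']|z]; rewrite mem_zeros in_set1; last first.
  by rewrite (negbTE (apex_notin_square z)).
rewrite mem_square square_slack (inj_eq inl_inj) xpair_eqE /= /s.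
by case: x; case: y; case: x'; case: y'; apply/esym; rewrite ?eqxx /=;
  by [apply/eqP; lra | apply/negbTE/eqP; lra].
Qed.

Lemma apex_indic z : indic R (inr z) \in W.
Proof.
apply/slack_spaceP; exists (sqc [:: 0; 0; - (~~ z)%:R; - z%:R]), 0.
apply/ffunP => i; rewrite !ffunE row4_mul_col4.
by case: i => [[x y]|w]; rewrite /= ?(inj_eq inr_inj) ?[_ == _]/(false);
  [lra | case: z; case: w => /=; lra].
Qed.

(** The square has 1, 4, 4, 1 faces of ranks 0 to 3; each apex adds this sequence to its
    own shift. *)
Lemma square_pyramid_counts :
  [/\ rk W setT = 5%N, #|rk_faces W setT 2%N| = 13%N &
                       #|rk_faces W setT 3%N| = 13%N].
Proof.
have pt := pointed_slack sqpt square; have rk3 := rk_square.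
have a1 := apex_notin_square false.
have a2 : inr true \notin inr false |: square.
  by rewrite in_setU1 (negbTE (apex_notin_square true)).
have -> : setT = inr true |: (inr false |: square).
  apply/setP => -[p|[]]; rewrite !inE //=.
  by apply/esym/imset_f.
have N0 : #|rk_faces W square 0%N| = 1%N by rewrite (rk_faces0 pt) cards1.
have N1 := square_vertices; have N2 := rk3_edges pt rk3.
have N3 : #|rk_faces W square 3%N| = 1%N.
  by have := rk_faces_max W square; rewrite rk3 => ->; rewrite cards1.
split.
- by rewrite !rk_cone ?rk3 //; apply: apex_indic.
- by rewrite !rk_faces_cone ?N0 ?N1 ?N2 ?N1 //; apply: apex_indic.
- by rewrite !rk_faces_cone ?N3 ?N2 ?N1 //; apply: apex_indic.
Qed.

End SquarePyramid.

(** * Simplicial polytopes with few missing edges *)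

Section Family.
Variables (R : realFieldType) (m d : nat) (al ga et : R).
Hypotheses (m_gt1 : (1 < m)%N) (md_gt2 : (2 < m + d)%N).
Hypotheses (al_gt0 : 0 < al) (ga_gt0 : 0 < ga) (al_ga : 2 * al + ga = 1).
Hypotheses (etE : et = 2 * (m%:R - 1) ^+ 2 * ga) (et_lt : et < al).

Local Notation N := (m + d).+2.
Local Notation I := (option 'I_N).
Local Notation vecs := {ffun I -> R^o}.
Local Notation vanish := (vanish R).

Definition node (k : nat) : R := k%:R - 1.

(** Points of the moment curve with parameters -1, 0, ..., m + d, and an apex [None]. The
    apex is a convex combination of the points with parameters -1, 0 and 1, pushed by [et]
    against the direction of the last axis. It is beyond those facets through the edge from
    -1 to 0 whose other vertices are consecutive parameters between 1 and [m]. Hence it is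
    joined to the parameters up to [m] but not to the [d] remaining ones. *)
Definition fampt (i : I) : 'rV[R]_4 :=
  \row_(j < 4) (if i is Some k
    then [:: node k; node k ^+ 2; node k ^+ 3; node k ^+ 4]
    else [:: ga - al; ga + al; ga - al; ga + al - et])`_j.

Local Notation W := (slack_space fampt).
Local Notation col4 t := (\col_(j < 4) t`_j).

(** Value at the apex of the affine function that is [p] along the moment curve. *)
Definition func (p : {poly R}) : R :=
  al * p.[-1] + al * p.[0] + ga * p.[1] - et * p`_4.

Definition polyvec (p : {poly R}) : vecs :=
  [ffun i : I => if i is Some k then p.[node k] else func p].

Lemma slack_polyvec (a b c e f : R) :
  slack fampt (col4 [:: - b; - c; - e; - f]) a =
  polyvec (\poly_(k < 5) [:: a; b; c; e; f]`_k).
Proof.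
apply/ffunP => i; rewrite !ffunE row4_mul_col4 /=.
case: i => [k|]; rewrite /func ?horner_poly ?coef_poly !big_ord_recl !big_ord0 /=.
  by rewrite /bump /=; ring.
have -> : ga = 1 - 2 * al by move: al_ga; lra.
rewrite /bump /=; ring.
Qed.

Lemma memWP (y : vecs) :
  reflect (exists2 p : {poly R}, (size p <= 5)%N & y = polyvec p) (y \in W).
Proof.
apply: (iffP (slack_spaceP _ _)) => [[c [b ->]]|[p sp ->]].
  exists (\poly_(k < 5) [:: b; - c 0 0; - c 1 0; - c 2 0; - c 3 0]`_k).
    exact: size_poly.
  rewrite -slack_polyvec !opprK; congr slack; apply/colP => j; rewrite mxE.
  by case: j => [[|[|[|[|j]]]] lj] //=; congr (c _ _); apply/val_inj.
exists (col4 [:: - p`_1; - p`_2; - p`_3; - p`_4]), p`_0.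
rewrite slack_polyvec; congr polyvec; apply/polyP => k; rewrite coef_poly.
case: ltnP => [|le]; last by rewrite nth_default // (leq_trans sp).
by case: k => [|[|[|[|[|]]]]].
Qed.

(** A monic quartic with prescribed roots, corrected by a multiple of a square; functions
    of this form expose all the edges. *)
Definition quartic (a b c e s la x : R) : R :=
  (x - a) * (x - b) * (x - c) * (x - e) + la * (x - s) ^+ 2.

Definition quartvec (a b c e s la : R) : vecs :=
  [ffun i : I => if i is Some k then quartic a b c e s la (node k)
    else al * quartic a b c e s la (-1) + al * quartic a b c e s la 0
         + ga * quartic a b c e s la 1 - et].

Lemma quartvec_mem a b c e s la : quartvec a b c e s la \in W.
Proof.
apply/slack_spaceP.
exists (col4 [:: - (- (a * b * c + a * b * e + a * c * e + b * c * e) - 2 * la * s);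
  - (a * b + a * c + a * e + b * c + b * e + c * e + la); a + b + c + e; -1]),
  (a * b * c * e + la * s ^+ 2).
apply/ffunP => i; rewrite !ffunE row4_mul_col4 /=.
case: i => [k|]; rewrite /quartic /=; first by ring.
have -> : ga = 1 - 2 * al by move: al_ga; lra.
by ring.
Qed.

Lemma node_inj : injective node.
Proof. by move=> a b /addIr /eqP; rewrite eqr_nat => /eqP. Qed.

Lemma node_sub a b : node a - node b = a%:R - b%:R.
Proof. by rewrite /node; ring. Qed.

Lemma node0 : node 0 = -1. Proof. by rewrite /node sub0r. Qed.
Lemma node1 : node 1 = 0. Proof. by rewrite /node subrr. Qed.
Lemma node2 : node 2 = 1. Proof. by rewrite /node; lra. Qed.

Lemma node_dist a b : a != b -> 1 <= `|node a - node b|.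
Proof.
rewrite node_sub neq_ltn => /orP[] ab.
  by rewrite distrC -natrB ?(ltnW ab) // normr_nat ler1n subn_gt0.
by rewrite -natrB ?(ltnW ab) // normr_nat ler1n subn_gt0.
Qed.

Lemma node_dist2 a b : a != b -> 1 <= (node a - node b) ^+ 2.
Proof. by move=> /node_dist ab; rewrite -real_normK ?num_real // exprn_ege1. Qed.

Lemma consec_ge0 a k : 0 <= (node k - node a) * (node k - node a.+1).
Proof.
rewrite !node_sub; case: (leqP k a) => ka.
  by apply: mulr_le0; rewrite subr_le0 ler_nat // ltnW.
by apply: mulr_ge0; rewrite subr_ge0 ler_nat // ltnW.
Qed.

Lemma et_gt0 : 0 < et.
Proof.
have h : 0 < m%:R - 1 :> R by rewrite subr_gt0 ltr1n.
by rewrite etE mulr_gt0 // mulr_gt0 ?ltr0n // exprn_gt0.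
Qed.

Lemma faceI (y : vecs) (Z : {set I}) : y \in W ->
    (forall i, i \in Z -> y i = 0) -> (forall i, i \notin Z -> 0 < y i) ->
  Z \in cone_faces W setT.
Proof.
move=> yW y0 ypos; apply/cone_facesP; exists y => //; split=> [i _|].
  by case: (boolP (i \in Z)) => [/y0 ->|/ypos/ltW].
apply/setP => i; rewrite mem_zeros in_setT /=.
by case: (boolP (i \in Z)) => [/y0 ->|/ypos/gt_eqF ->]; rewrite ?eqxx.
Qed.

Definition curve_set (P : pred nat) : {set I} :=
  [set i : I | if i is Some k then P (val k) else false].

(** Exposed by [(x - s)^2 * (x - t)^2]. If -1 or 0 is not a root, the value there is at
    least 1, and [et < al] makes the value at the apex positive. Taking for [t] a node beyond
    the last one gives the vertex [s]. *)
Lemma curve_face s t : (s != 0) && (t != 0) || (s != 1) && (t != 1) ->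
  curve_set (pred2 s t) \in cone_faces W setT.
Proof.
move=> st; have qE x : quartic (node s) (node s) (node t) (node t) 0 0 x =
    (x - node s) ^+ 2 * (x - node t) ^+ 2 by rewrite /quartic; ring.
apply: (faceI (quartvec_mem (node s) (node s) (node t) (node t) 0 0)).
  move=> [k|]; rewrite inE // ffunE qE => /pred2P[] ->.
    by rewrite subrr expr0n mul0r.
  by rewrite subrr expr0n mulr0.
have sq1 a : a != s -> a != t -> 1 <= (node a - node s) ^+ 2 * (node a - node t) ^+ 2.
  by move=> sa ta; rewrite mulr_ege1 ?node_dist2.
have ge0 x : 0 <= (x - node s) ^+ 2 * (x - node t) ^+ 2.
  by rewrite mulr_ge0 ?sqr_ge0.
move=> [k|]; rewrite inE ffunE !qE.
  rewrite negb_or => /andP[ks kt].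
  exact: lt_le_trans (sq1 _ ks kt).
have e0 a : -1 - node a = node 0 - node a by rewrite node0.
have e1 a : 0 - node a = node 1 - node a by rewrite node1.
have e2 a : 1 - node a = node 2 - node a by rewrite node2.
move=> _; rewrite !e0 !e1 !e2.
have a0 := ge0 (node 0); have a1 := ge0 (node 1); have a2 := ge0 (node 2).
have {a2} := mulr_ge0 (ltW ga_gt0) a2.
case/orP: st => /andP[s0 t0].
  have := sq1 0%N; rewrite eq_sym s0 eq_sym t0 => /(_ isT isT).
  move: a0 a1; set A := _ * _; set B := _ * _; set C := ga * _.
  move: al_gt0 et_lt => h1 h2 hA hB hC; nra.
have := sq1 1%N; rewrite eq_sym s0 eq_sym t0 => /(_ isT isT).
move: a0 a1; set A := _ * _; set B := _ * _; set C := ga * _.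
move: al_gt0 et_lt => h1 h2 hA hB hC; nra.
Qed.

Lemma consec_gt0 a k : k != a -> k != a.+1 ->
  0 < (node k - node a) * (node k - node a.+1).
Proof.
move=> ka ka1; rewrite lt_def consec_ge0 andbT.
by rewrite mulf_neq0 // subr_eq0 (inj_eq node_inj).
Qed.

(** The edge from -1 to 0 survives because not all facets around it are visible from the
    apex: it is exposed by [x * (x + 1) * (x - m - d - 1)^2]. *)
Lemma base_face : curve_set (pred2 0 1)%N \in cone_faces W setT.
Proof.
have qE x : quartic (node 0) (node 1) (node N) (node N) 0 0 x =
    ((x - node 0) * (x - node 1)) * (x - node N) ^+ 2 by rewrite /quartic; ring.
apply: (faceI (quartvec_mem (node 0) (node 1) (node N) (node N) 0 0)).
  by move=> [k|]; rewrite inE // ffunE qE => /pred2P[] ->; rewrite subrr ?mul0r ?mulr0 ?mul0r.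
move=> [k|]; rewrite inE ffunE !qE.
  rewrite negb_or => /andP[k0 k1]; rewrite mulr_gt0 ?consec_gt0 //.
  have := @node_dist2 k N; rewrite ltn_eqF // => /(_ isT).
  exact: lt_le_trans.
move=> _; rewrite node0 node1 etE /node -addn2 !natrD.
have M1 : 1 <= m%:R - 1 :> R by rewrite lerBrDr -(natrD _ 1 1) ler_nat.
have d0 : 0 <= d%:R :> R by rewrite ler0n.
have lt : (m%:R - 1) ^+ 2 < (m%:R + d%:R) ^+ 2 :> R by nra.
rewrite -subr_gt0 in lt; have := mulr_gt0 ga_gt0 lt; lra.
Qed.

(** The quartic with roots -1, 0, [a], [b] is negative at the apex by the last hypothesis.
    Adding the right multiple of [(x - node k)^2] makes it zero there and leaves only the
    root [node k] on the curve. *)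
Lemma apex_face_aux a b (k : 'I_N) :
    (forall i, 0 <= (node i - node 0) * (node i - node 1) * (node i - a) * (node i - b)) ->
    (node k - node 0) * (node k - node 1) * (node k - a) * (node k - b) = 0 ->
    2 * ga * ((1 - a) * (1 - b)) < et ->
  [set None; Some k] \in cone_faces W setT.
Proof.
move=> B0 Bk lt.
pose D := al * (node 0 - node k) ^+ 2 + al * (node 1 - node k) ^+ 2 +
          ga * (node 2 - node k) ^+ 2.
have D0 : 0 < D.
  have h0 := mulr_ge0 (ltW al_gt0) (sqr_ge0 (node 0 - node k)).
  have h1 := mulr_ge0 (ltW al_gt0) (sqr_ge0 (node 1 - node k)).
  have h2 := mulr_ge0 (ltW ga_gt0) (sqr_ge0 (node 2 - node k)).
  case: (eqVneq (k : nat) 0%N) => k0.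
    have : 0 < al * (node 1 - node k) ^+ 2.
      by rewrite mulr_gt0 // (lt_le_trans ltr01) // node_dist2 // k0.
    by rewrite /D; lra.
  have : 0 < al * (node 0 - node k) ^+ 2.
    by rewrite mulr_gt0 // (lt_le_trans ltr01) // node_dist2 // eq_sym.
  by rewrite /D; lra.
pose la := (et - 2 * ga * ((1 - a) * (1 - b))) / D.
have la0 : 0 < la by rewrite divr_gt0 // subr_gt0.
apply: (faceI (quartvec_mem (node 0) (node 1) a b (node k) la)).
  move=> i; rewrite !inE => /orP[] /eqP ->; rewrite ffunE; last first.
    by rewrite /quartic Bk subrr expr0n mulr0 addr0.
  have -> : et = 2 * ga * ((1 - a) * (1 - b)) + la * D.
    by rewrite divfK ?gt_eqF //; ring.
  by rewrite /quartic /D node0 node1 node2; ring.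
move=> [i|]; rewrite !inE // orFb ffunE => ik.
by rewrite /quartic ltr_wpDl ?B0 // mulr_gt0 // (lt_le_trans ltr01) // node_dist2.
Qed.

(** For a parameter [t] with [1 <= t <= m] the quartic is [x * (x + 1) * (x - t) * (x - t + 1)],
    nonnegative at integers. At the apex it has the sign of [(t - 1) * (t - 2) - (m - 1)^2].
    For the parameters -1 and 0 the quartic [x * (x + 1) * (x - 1)^2] serves. *)
Lemma apex_face (k : 'I_N) : (k <= m.+1)%N -> [set None; Some k] \in cone_faces W setT.
Proof.
have [M1 et0] : 1 <= m%:R - 1 :> R /\ 0 < et.
  by rewrite lerBrDr -(natrD _ 1 1) ler_nat et_gt0.
have small : (k <= 1)%N -> [set None; Some k] \in cone_faces W setT.
  move=> k1; apply: (@apex_face_aux 1 1); last by rewrite subrr mul0r mulr0.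
    by move=> i; rewrite -mulrA mulr_ge0 ?consec_ge0 // -expr2 sqr_ge0.
  by case: (val k) k1 => [|[|]] //; rewrite subrr ?mulr0 ?mul0r.
case: (leqP k 1) => [/small //|k1 km].
case kE : (val k) => [|[|k']]; try by rewrite kE in k1.
apply: (@apex_face_aux (node k'.+1) (node k'.+2)) => [i||].
- by rewrite -mulrA mulr_ge0 ?consec_ge0.
- by rewrite kE subrr mulr0.
have : (k'.+1)%:R <= m%:R :> R by rewrite ler_nat -ltnS -kE.
rewrite etE /node -addn2 natrD -addn1 natrD => kM.
have : 0 <= k'%:R :> R by rewrite ler0n.
set x := k'%:R in kM *; set M := m%:R in M1 kM *; move=> x0.
have lt : (x - 1) * x < (M - 1) ^+ 2 by nra.
rewrite -subr_gt0 in lt; have := mulr_gt0 ga_gt0 lt; lra.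
Qed.

(** The leading coefficient of a quartic is its divided difference at -1, 0, 1, [m], [t].
    This writes the apex as an affine combination of these five points in which [t] alone
    has a negative coefficient. So a nonnegative function that vanishes at the apex and at
    [t] vanishes at 0 too. *)
Lemma apex_nonface (k : 'I_N) (Z : {set I}) :
    (m.+1 < k)%N -> Z \in cone_faces W setT -> None \in Z -> Some k \in Z ->
  exists i : 'I_N, (i == 1%N :> nat) && (Some i \in Z).
Proof.
move=> mk /cone_facesP[_ /memWP[p sp ->] [y0 ->]].
have kN := ltn_ord k.
have lt0 : (0 < N)%N by []. have lt1 : (1 < N)%N by [].
have lt2 : (2 < N)%N by lia. have ltm : (m.+1 < N)%N by lia.
rewrite !mem_zeros !in_setT !ffunE /= => /eqP pq /eqP pk.
exists (Ordinal lt1); rewrite mem_zeros in_setT ffunE /=; apply/eqP.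
have := y0 (Some (Ordinal lt0)) (in_setT _); have := y0 (Some (Ordinal lt1)) (in_setT _).
have := y0 (Some (Ordinal lt2)) (in_setT _); have := y0 (Some (Ordinal ltm)) (in_setT _).
rewrite !ffunE /= node0 node1 node2.
set M : R := m%:R; have -> : node m.+1 = M by rewrite /node -addn1 natrD addrK.
have M1 : 1 < M by rewrite ltr1n.
set t := node k; have Mt : M < t.
  by rewrite /M /t /node ltrBrDr -(natrD _ m 1) ltr_nat addn1.
move=> pM p2 p1 p0.
(* Lagrange interpolation of the leading coefficient at five points. *)
have id : func p = (al - et / (2 * (1 + M) * (1 + t))) * p.[-1]
    + (al + et / (M * t)) * p.[0]
    + (ga - et / (2 * (M - 1) * (t - 1))) * p.[1]
    + et / ((M + 1) * M * (M - 1) * (t - M)) * p.[M]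
    - et / ((t + 1) * t * (t - 1) * (t - M)) * p.[t].
  rewrite /func !(horner_coef_wide _ sp) !big_ord_recl !big_ord0 /= /bump /=.
  by field; do !(apply/andP; split); apply: lt0r_neq0; lra.
have et0 := et_gt0.
have A0 : 0 <= al - et / (2 * (1 + M) * (1 + t)).
  rewrite subr_ge0 ler_pdivrMr; last by rewrite !mulr_gt0 //; lra.
  have : 1 <= 2 * (1 + M) * (1 + t) by nra.
  move=> h; apply: le_trans (ltW et_lt) _; rewrite ler_peMr //; exact: ltW.
have C0 : 0 <= ga - et / (2 * (M - 1) * (t - 1)).
  rewrite subr_ge0 ler_pdivrMr; last by rewrite !mulr_gt0 //; lra.
  rewrite etE -/M -subr_ge0.
  have -> : ga * (2 * (M - 1) * (t - 1)) - 2 * (M - 1) ^+ 2 * ga =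
     ga * ((M - 1) * (t - M)) * 2 by ring.
  by rewrite !mulr_ge0 ?(ltW ga_gt0) ?subr_ge0 ?(ltW M1) ?(ltW Mt).
have D0 : 0 <= et / ((M + 1) * M * (M - 1) * (t - M)).
  by rewrite divr_ge0 ?(ltW et0) // !mulr_ge0 //; lra.
have B0 : 0 < al + et / (M * t).
  by rewrite addr_gt0 // divr_gt0 // mulr_gt0 //; lra.
move: id; rewrite pq pk mulr0 subr0 => id.
have hA := mulr_ge0 A0 p0; have hC := mulr_ge0 C0 p2; have hD := mulr_ge0 D0 pM.
have hB : (al + et / (M * t)) * p.[0] <= 0 by lra.
by apply/le_anti; rewrite p1 andbT -(pmulr_rle0 _ B0).
Qed.

Definition curve_part (Z : {set I}) : {set 'I_N} := [set k | Some k \in Z].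

Lemma card_curve_part (Z : {set I}) : #|Z| = ((None \in Z) + #|curve_part Z|)%N.
Proof.
rewrite (cardsD1 None); congr (_ + _)%N.
rewrite -(card_imset (curve_part Z) (@Some_inj _)); apply: eq_card => -[k|].
  by rewrite in_setD1 /= (mem_imset _ _ (@Some_inj _)) inE.
by rewrite in_setD1 eqxx; apply/esym/negbTE/imsetP => -[].
Qed.

Lemma nodes_uniq (S : {set 'I_N}) : uniq [seq node k | k : 'I_N <- enum S].
Proof.
by rewrite map_inj_uniq ?enum_uniq // => a b /node_inj /val_inj.
Qed.

Lemma root_nodes (S : {set 'I_N}) (p : {poly R}) :
  {in S, forall k : 'I_N, p.[node k] = 0} ->
  all (root p) [seq node k | k : 'I_N <- enum S].
Proof.
move=> pS; apply/allP => _ /mapP[k + ->]; rewrite mem_enum => kS.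
by apply/rootP/pS.
Qed.

Lemma few_nodes (S : {set 'I_N}) (p : {poly R}) : (size p <= 5)%N -> p != 0 ->
  {in S, forall k : 'I_N, p.[node k] = 0} -> (#|S| <= 4)%N.
Proof.
move=> sp p0 pS; rewrite -ltnS (leq_trans _ sp) // cardE -(size_map (fun k : 'I_N => node k)).
exact: max_poly_roots p0 (root_nodes pS) (nodes_uniq S).
Qed.

Lemma four_nodes (S : {set 'I_N}) (p : {poly R}) : (size p <= 5)%N -> p != 0 ->
    {in S, forall k : 'I_N, p.[node k] = 0} -> #|S| = 4%N ->
  p`_4 != 0 /\ forall x, p.[x] = p`_4 * \prod_(k in S) (x - node k).
Proof.
move=> sp p0 pS S4.
have sp5 : size p = (size [seq node k | k : 'I_N <- enum S]).+1.
  apply/anti_leq; rewrite size_map -cardE S4 sp -S4 cardE -(size_map (fun k : 'I_N => node k)).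
  exact: max_poly_roots p0 (root_nodes pS) (nodes_uniq S).
have := all_roots_prod_XsubC sp5 (root_nodes pS).
rewrite uniq_rootsE nodes_uniq => /(_ isT).
have -> : lead_coef p = p`_4.
  by rewrite /lead_coef sp5 size_map -cardE S4.
move=> pE; split.
  have -> : p`_4 = lead_coef p by rewrite /lead_coef sp5 size_map -cardE S4.
  by rewrite lead_coef_eq0.
move=> x; rewrite [in LHS]pE hornerZ big_map horner_prod big_enum /=.
by congr (_ * _); apply: eq_bigr => k _; rewrite hornerXsubC.
Qed.

Lemma polyvec_ge0 (p : {poly R}) :
  {in [set: I], forall i, 0 <= polyvec p i} ->
  (forall k, (k < N)%N -> 0 <= p.[node k]) /\ 0 <= func p.
Proof.
move=> y0; split=> [k kN|].
  by have := y0 (Some (Ordinal kN)) (in_setT _); rewrite ffunE.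
by have := y0 None (in_setT _); rewrite ffunE.
Qed.

Lemma consec_not_square a b : (0 < b)%N -> (a * a.+1 <> b ^ 2)%N.
Proof. by move=> b0; rewrite -mulnn; case: (leqP b a) => ab; nia. Qed.

(** General position. A fifth zero could only be the apex, in addition to four nodes.
    Since the value at the apex is then zero, -1 and 0 are among these nodes. As the quartic
    is nonnegative at all nodes, the other two are consecutive integers, say [a] and
    [a + 1]. The value at the apex is now a nonzero multiple of [a * (a - 1) - (m - 1)^2],
    which is not zero because the product of two consecutive integers is not a
    positive square. *)
Lemma few_zeros (p : {poly R}) : (size p <= 5)%N -> p != 0 ->
    {in [set: I], forall i, 0 <= polyvec p i} ->
  (#|zeros setT (polyvec p)| <= 4)%N.
Proof.
move=> sp p0 /polyvec_ge0[pge fge]; set Z := zeros _ _; set S := curve_part Z.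
have pS : {in S, forall k : 'I_N, p.[node k] = 0}.
  by move=> k; rewrite inE mem_zeros in_setT ffunE => /eqP.
have S4 := few_nodes sp p0 pS.
rewrite (card_curve_part Z) -/S; case: (boolP (None \in Z)) => // NZ.
rewrite add1n ltn_neqAle S4 andbT; apply/negP => /eqP {}S4.
have [lc pE] := four_nodes sp p0 pS S4.
have pq : func p = 0 by move: NZ; rewrite mem_zeros in_setT ffunE => /eqP.
have lt0 : (0 < N)%N by []. have lt1 : (1 < N)%N by [].
have lt2 : (2 < N)%N by lia.
have et0 := et_gt0.
have g0 := pge 0%N lt0; have g1 := pge 1%N lt1; have g2 := pge 2%N lt2.
have funcE : func p = al * p.[node 0] + al * p.[node 1] + ga * p.[node 2] - et * p`_4.
  by rewrite node0 node1 node2.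
have a0 := mulr_ge0 (ltW al_gt0) g0; have a1 := mulr_ge0 (ltW al_gt0) g1.
have a2 := mulr_ge0 (ltW ga_gt0) g2.
(* A negative leading coefficient would make the value at the apex positive. *)
have lc0 : 0 < p`_4.
  rewrite lt_neqAle eq_sym lc /= leNgt; apply/negP => lc0.
  have : 0 < et * - p`_4 by rewrite mulr_gt0 // oppr_gt0.
  by move: pq; rewrite funcE; lra.
(* The distance of two nodes is at least 1. *)
have lc_le (i : 'I_N) : i \notin S -> p`_4 <= p.[node i].
  move=> iS; have := pge i (ltn_ord i).
  move=> /normr_idP <-; rewrite pE normrM (gtr0_norm lc0) ler_peMr ?(ltW lc0) //.
  rewrite normr_prod; apply: (big_ind (fun z : R => 1 <= z)) => //.
    by move=> x y; apply: mulr_ege1.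
  move=> k kS; apply: node_dist.
  by apply: contraNneq iS => /val_inj ->.
have alet : et * p`_4 < al * p`_4 by rewrite ltr_pM2r.
have S0 : Ordinal lt0 \in S.
  apply: contraT => /lc_le /= le; have := ler_wpM2l (ltW al_gt0) le.
  by move: pq; rewrite funcE; lra.
have S1 : Ordinal lt1 \in S.
  apply: contraT => /lc_le /= le; have := ler_wpM2l (ltW al_gt0) le.
  by move: pq; rewrite funcE; lra.
have : #|S :\ Ordinal lt0 :\ Ordinal lt1| == 2%N.
  have n01 : Ordinal lt1 != Ordinal lt0 by rewrite -val_eqE.
  move: S4; rewrite (cardsD1 (Ordinal lt0)) S0 (cardsD1 (Ordinal lt1)) in_setD1 S1.
  by rewrite n01 !add1n => -[->].
have {}pE x : p.[x] = p`_4 * ((x - node 0) * ((x - node 1) *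
    \prod_(k in S :\ Ordinal lt0 :\ Ordinal lt1) (x - node k))).
  rewrite pE (bigD1 (Ordinal lt0)) //= (bigD1 (Ordinal lt1)) /=; last first.
    by rewrite S1.
  congr (_ * (_ * (_ * _))); apply: eq_bigl => k; rewrite !in_setD1.
  by rewrite andbC; congr (_ && _); rewrite andbC.
move=> /cards2P[a [b [ab Sab]]].
have [a' [b' [a1' ab' bN pE']]] : exists a' b', [/\ (1 < a')%N, (a' < b')%N, (b' < N)%N &
    forall x, p.[x] = p`_4 * ((x - node 0) * (x - node 1)) * ((x - node a') * (x - node b'))].
  have ge2 (k : 'I_N) : k \in S :\ Ordinal lt0 :\ Ordinal lt1 -> (1 < k)%N.
    by rewrite !in_setD1 -!val_eqE /=; case: (val k) => [|[|]].
  have a2' : (1 < a)%N by apply: ge2; rewrite Sab set21.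
  have b2' : (1 < b)%N by apply: ge2; rewrite Sab set22.
  have pab x : p.[x] = p`_4 * ((x - node 0) * (x - node 1)) * ((x - node a) * (x - node b)).
    by rewrite pE Sab big_setU1 ?in_set1 //= big_set1; ring.
  case: (ltngtP a b) => [lt|lt|/val_inj eqab]; last by rewrite eqab eqxx in ab.
    by exists a, b; split.
  by exists b, a; split=> // x; rewrite pab; ring.
(* Otherwise the quartic is negative at the node following [a']. *)
have b'E : b' = a'.+1.
  apply/eqP; apply: contraT => neq.
  have := pge a'.+1 (leq_ltn_trans ab' bN); rewrite leNgt => /negP; case.
  rewrite pE' pmulr_rlt0; last first.
    by rewrite mulr_gt0 // consec_gt0 // eqSS -lt0n ltnW.
  rewrite !node_sub pmulr_rlt0 ?subr_lt0 ?subr_gt0 ?ltr_nat //.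
  by rewrite ltn_neqAle eq_sym neq.
have : func p = p`_4 * (2 * ga * ((1 - node a') * (1 - node a'.+1) - (m%:R - 1) ^+ 2)).
  by rewrite funcE !pE' b'E etE node0 node1 node2; ring.
move: a1'; case: a' {ab' pE'} b'E => [|[|a']] // b'E _.
rewrite pq => /esym/eqP; rewrite !mulf_eq0 (gt_eqF lc0) (gt_eqF ga_gt0) pnatr_eq0 /=.
rewrite subr_eq0 /node.
have -> : (1 - (a'.+2%:R - 1)) * (1 - (a'.+3%:R - 1)) = (a' * a'.+1)%N%:R :> R.
  by rewrite -addn3 -addn2 -addn1 !natrM !natrD; ring.
have <- : (m - 1)%N%:R = m%:R - 1 :> R by rewrite natrB // ltnW.
rewrite -natrX eqr_nat => /eqP.
by apply: consec_not_square; rewrite subn_gt0.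
Qed.

Lemma polyvec0 : polyvec 0 = 0.
Proof.
apply/ffunP => -[k|]; rewrite !ffunE ?horner0 // /func !horner0 coef0.
by rewrite !mulr0 subr0 !addr0.
Qed.

Lemma proper_face_card (Z : {set I}) : Z \in cone_faces W setT -> Z != setT ->
  (#|Z| <= 4)%N.
Proof.
move=> /cone_facesP[_ /memWP[p sp ->] [y0 ->]] neq.
apply: few_zeros => //; apply: contraNneq neq => ->.
by apply/eqP/setP => i; rewrite mem_zeros polyvec0 ffunE eqxx in_setT.
Qed.

(** Products of the first factors [x - node k] separate the first five points, and a
    quartic with five roots is zero. *)
Lemma rk_family : rk W setT = 5%N.
Proof.
pose Z r : {set I} := curve_set (fun k => k < r)%N.
have mZ r (k : 'I_N) : (Some k \in Z r) = (k < r)%N by rewrite inE.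
have N5 : (5 <= N)%N by lia.
have card5 : curve_part (Z 5) = [set k : 'I_N | k < 5]%N.
  by apply/setP => k; rewrite !inE.
have c5 : #|[set k : 'I_N | k < 5]%N| = 5%N.
  have winj : injective (widen_ord N5) by move=> a b /(congr1 val) /= /val_inj.
  rewrite -[RHS](card_ord 5) -(card_imset _ winj).
  apply: eq_card => k; rewrite inE; apply/idP/imsetP => [k5|[l _ ->]].
    by exists (Ordinal k5) => //; apply: val_inj.
  by rewrite /= ltn_ord.
apply/anti_leq/andP; split.
  rewrite (@rk_closure _ _ W (Z 5) setT) ?subsetT //.
    by rewrite -{2}c5 -card5; apply: leq_trans (rk_card _ _) _; rewrite card_curve_part inE.
  move=> _ /memWP[p sp ->] /vanishP pZ; have p0 : p = 0.
    apply/eqP; apply: contraT => p0.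
    suff : (#|[set k : 'I_N | k < 5]%N| <= 4)%N by rewrite c5.
    apply: (few_nodes sp p0) => k; rewrite inE => k5.
    by have := pZ (Some k); rewrite mZ ffunE; apply.
  by rewrite p0 polyvec0 mem0v.
have step r : (r < 5)%N -> (rk W (Z r) < rk W (Z r.+1))%N.
  move=> r5; have rN : (r < N)%N by apply: leq_trans N5.
  pose p := \prod_(k <- enum 'I_r) ('X - (node k)%:P).
  apply: (@rk_ltn _ _ W _ _ (polyvec p)).
  - by apply/subsetP => -[k|]; rewrite !inE // => /ltnW.
  - by apply/memWP; exists p => //; rewrite size_prod_XsubC size_enum_ord.
  - apply/vanishP => -[k|]; rewrite inE // => kr; rewrite ffunE horner_prod big_enum.
    by rewrite (bigD1 (Ordinal kr)) //= hornerXsubC subrr mul0r.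
  apply/vanishP => /(_ (Some (Ordinal rN))); rewrite mZ /= => /(_ (ltnSn r)).
  rewrite ffunE horner_prod big_enum => /eqP; apply/negP/prodf_neq0 => k _.
  by rewrite hornerXsubC subr_eq0 (inj_eq node_inj) /= gtn_eqF.
have rZ r : (r <= 5)%N -> (r <= rk W (Z r))%N.
  by elim: r => // r IHr r5; apply: leq_ltn_trans (IHr (ltnW r5)) (step r r5).
exact: leq_trans (rZ 5%N (leqnn _)) (rk_subset _ (subsetT _)).
Qed.

(** A facet has rank four and at most four points, which are therefore independent, and
    so are the points of each of its faces. *)
Lemma rk_proper_face (Z : {set I}) : Z \in cone_faces W setT -> Z != setT ->
  rk W Z = #|Z|.
Proof.
move=> Zf ZT; apply/anti_leq; rewrite rk_card /=.
have [G] := coatom_above (pointed_slack fampt setT) Zf ZT.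
rewrite rk_family in_rk_faces => /andP[Gf /eqP rkG] ZG.
have GT : G != setT by apply: contra_eq_neq rkG => ->; rewrite rk_family.
rewrite -(leq_add2r #|G :\: Z|) -{1}(setIidPr ZG) cardsID.
apply: leq_trans (proper_face_card Gf GT) _.
apply: leq_trans (rk_setU_leq W Z (G :\: Z)).
have -> : Z :|: G :\: Z = G by rewrite -{1}(setIidPr ZG) setID.
by rewrite rkG.
Qed.

Lemma rk_facesE r : (r < 5)%N ->
  rk_faces W setT r = [set Z in cone_faces W setT | #|Z| == r].
Proof.
move=> r5; apply/setP => Z; rewrite in_rk_faces in_set.
case: (boolP (Z \in cone_faces _ _)) => //= Zf.
case: (eqVneq Z setT) => [->|ZT]; last by rewrite rk_proper_face.
rewrite rk_family gtn_eqF // cardsT card_option card_ord gtn_eqF //; lia.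
Qed.

Lemma family_vertices : #|rk_faces W setT 1%N| = (m + d).+3.
Proof.
rewrite (rk_faces1_card (pointed_slack fampt setT)) ?cardsT ?card_option ?card_ord //.
move=> [k|] _.
  have -> : [set Some k] = curve_set (pred2 (val k) N).
    apply/setP => -[l|]; rewrite !inE //=.
    by rewrite (ltn_eqF (ltn_ord l)) orbF (inj_eq (@Some_inj _)) -val_eqE.
  by apply: curve_face; case: (val k) => [|[|]].
have lt0 : (0 < N)%N by []. have lt1 : (1 < N)%N by [].
have f0 := @apex_face (Ordinal lt0) isT; have f1 := @apex_face (Ordinal lt1) isT.
have -> : [set None] = [set None; Some (Ordinal lt0)] :&: [set None; Some (Ordinal lt1)].
  by apply/setP => -[[[|[|l]] ll]|]; rewrite !inE.
exact: cone_face_cap.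
Qed.

Lemma family_edges :
  #|rk_faces W setT 2%N| = ('C((m + d).+3, 2) - d)%N.
Proof.
rewrite rk_facesE //.
pose bad := [set [set None; Some k] | k : 'I_N & (m.+1 < k)%N].
have inj : injective (fun k : 'I_N => [set None; Some k] : {set I}).
  move=> a b /setP/(_ (Some a)); rewrite !inE eqxx /= => /esym/eqP.
  exact: Some_inj.
have cbad : #|bad| = d.
  rewrite card_imset //.
  have lt : forall i : 'I_d, (m.+2 + i < N)%N by move=> i; have := ltn_ord i; lia.
  rewrite -[RHS](card_ord d).
  have injs : injective (fun i : 'I_d => Ordinal (lt i)).
    by move=> a b /(congr1 val) /= /addnI /val_inj.
  rewrite -(card_imset _ injs); apply: eq_card => k.
  rewrite [LHS]inE; apply/idP/imsetP => [mk|[i _ ->]]; last by rewrite /= leq_addr.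
  have lt' : (k - m.+2 < d)%N by have := ltn_ord k; lia.
  by exists (Ordinal lt') => //; apply: val_inj; rewrite /= subnKC.
have all2 : [set Z : {set I} | #|Z| == 2%N] =
   [set Z in cone_faces W setT | #|Z| == 2%N] :|: bad.
  apply/setP => Z; rewrite in_setU [LHS]in_set [X in _ = X || _]in_set.
  apply/idP/orP => [|[/andP[] //|/imsetP[k _ ->]]]; last by rewrite cards2.
  move=> /[dup] Z2 /cards2P[a [b [ab ZE]]]; rewrite Z2 andbT ZE.
  have apex (k : 'I_N) : [set None; Some k] \in cone_faces W setT \/
      [set None; Some k] \in bad.
    case: (leqP k m.+1) => km; first by left; apply: apex_face.
    by right; apply/imsetP; exists k; rewrite ?inE.
  case: a b ab {ZE} => [a|] [b|] // ab; last by rewrite setUC; apply: apex.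
  left; have -> : [set Some a; Some b] = curve_set (pred2 (val a) (val b)).
    by apply/setP => -[k|]; rewrite !inE.
  case: (boolP ((val a != 0) && (val b != 0) || (val a != 1) && (val b != 1))%N) => [|np].
    exact: curve_face.
  have : (val a == 0%N) && (val b == 1%N) || (val a == 1%N) && (val b == 0%N).
    move: ab np; rewrite (inj_eq (@Some_inj _)) -val_eqE /=.
    by case: (val a) => [|[|]]; case: (val b) => [|[|]].
  case/orP => /andP[/eqP -> /eqP ->]; first exact: base_face.
  suff -> : curve_set (pred2 1 0)%N = curve_set (pred2 0 1)%N by exact: base_face.
  by apply/setP => -[k|]; rewrite !inE // orbC.
have disj : [set Z in cone_faces W setT | #|Z| == 2%N] :&: bad = set0.
  apply/setP => Z; rewrite in_setI in_set0 [X in X && _]in_set; apply/negP.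
  move=> /andP[/andP[Zf _] /imsetP[k + ZE]]; rewrite inE => mk.
  have [||i] := @apex_nonface k Z mk Zf; rewrite ?ZE ?set21 ?set22 //.
  move=> /andP[/eqP i1]; rewrite !inE /= => /eqP[ik].
  by move: mk; rewrite -ik i1.
have := cardsUI [set Z in cone_faces W setT | #|Z| == 2%N] bad.
rewrite -all2 disj cards0 addn0 cbad.
have -> : #|[set Z : {set I} | #|Z| == 2%N]| = 'C((m + d).+3, 2).
  by rewrite card_draws card_option card_ord.
by move=> ->; rewrite addnK.
Qed.

Lemma family_2faces :
  #|rk_faces W setT 3%N| = (2 * ('C((m + d).+3, 2) - d - (m + d).+3))%N.
Proof.
rewrite (rk5_simplicial (pointed_slack fampt setT) rk_family) ?family_edges ?family_vertices //.
by move=> G; rewrite rk_facesE // inE => /andP[_ /eqP].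
Qed.

End Family.

From mathcomp Require Import classical_sets cardinality.
From mathcomp Require Import reals.
From mathcomp Require Import polyrcf.

(** * Faces of a polytope as zero sets of slack vectors *)

Local Open Scope classical_set_scope.

Section Hull.
Variables (R : realType) (I : finType) (m : nat) (v : I -> 'rV[R]_m).
Local Notation vecs := {ffun I -> R^o}.
Local Notation slack := (slack v).
Local Notation slack_space := (slack_space v).
Local Notation direction_space := (direction_space v).
Local Notation allI := [set: I]%SET.
Implicit Types (Z : {set I}) (c : 'cV[R]_m) (b : R).

Let in_allI (i : I) : (i \in allI) = true.
Proof. exact: finset.in_setT. Qed.

Definition vhull Z : set 'rV[R]_m := convex_hull [set v i | i in [set` Z]].

Lemma vhullP Z x : vhull Z x <-> exists t : I -> R,
  [/\ forall i, 0 <= t i, \sum_(i in Z) t i = 1 & x = \sum_(i in Z) t i *: v i].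
Proof.
split=> [[k [a [t [aZ t0 t1 ->]]]]|[t [t0 t1 ->]]].
  have /choice[j jP] : forall l, exists i, i \in Z /\ v i = a l.
    by move=> l; have [i iZ <-] := aZ l; exists i.
  exists (fun i => \sum_(l | j l == i) t l); split.
  - by move=> i; apply: sumr_ge0.
  - rewrite -t1 [RHS](partition_big j (mem Z)) // => l _; exact: (jP l).1.
  rewrite (partition_big j (mem Z)) => [|l _]; last exact: (jP l).1.
  apply: eq_bigr => i _; rewrite scaler_suml; apply: eq_bigr => l /andP[_ /eqP <-].
  by rewrite (jP l).2.
exists #|Z|, (fun l => v (enum_val l)), (fun l => t (enum_val l)); split=> //.
- by move=> l; exists (enum_val l) => //=; apply: enum_valP.
- by rewrite -t1 [RHS]big_enum_val.
- by rewrite big_enum_val.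
Qed.

Lemma vhull_v Z i : i \in Z -> vhull Z (v i).
Proof.
move=> iZ; apply/vhullP; exists (fun k => (k == i)%:R); split=> //.
- by rewrite (bigD1 i) //= eqxx big1 ?addr0 // => k /andP[_ /negbTE ->].
- rewrite (bigD1 i) //= eqxx scale1r big1 ?addr0 // => k /andP[_ /negbTE ->].
  by rewrite scale0r.
Qed.

Lemma mul_sum_slack (t : I -> R) Z c b : \sum_(i in Z) t i = 1 ->
  \sum_(i in Z) t i * slack c b i = b - ((\sum_(i in Z) t i *: v i) *m c) 0 0.
Proof.
move=> t1; rewrite mulmx_suml summxE -{2}[b]mul1r -t1 mulr_suml -sumrB.
by apply: eq_bigr => i _; rewrite ffunE -scalemxAl mulrBr !mxE.
Qed.

(** The slack at a convex combination is the same combination of slacks; if it is zero, the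
    weights are concentrated on the zeros. *)
Lemma vhull_zeros c b : (forall i, 0 <= slack c b i) ->
  vhull (zeros allI (slack c b)) =
  vhull allI `&` [set x | (x *m c) 0 0 = b].
Proof.
move=> y0; apply/seteqP; split=> x /=.
  move=> xZ; split.
    have [k [a [t [aZ t0 t1 ->]]]] := xZ; exists k, a, t; split=> // l.
    by have [i _ <-] := aZ l; exists i => //=; rewrite in_allI.
  have /vhullP[t [_ t1 xE]] := xZ.
  have := mul_sum_slack c b t1; rewrite -xE big1 => [|i]; first by lra.
  by rewrite mem_zeros => /andP[_ /eqP ->]; rewrite mulr0.
move=> [/vhullP[t [t0 t1 xE]] xb].
have sum0 : \sum_(i in allI) t i * slack c b i = 0.
  by rewrite mul_sum_slack // -xE xb subrr.
have tz i : i \notin zeros allI (slack c b) -> t i = 0.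
  rewrite mem_zeros in_allI /= => yi.
  have /eqP := psumr_eq0P (fun k _ => mulr_ge0 (t0 k) (y0 k)) sum0 (in_allI i).
  by rewrite mulf_eq0 (negbTE yi) orbF => /eqP.
apply/vhullP; exists t; split=> //.
- rewrite -t1 [RHS](bigID (mem (zeros allI (slack c b)))) /= [X in _ + X]big1 => [|i].
    by rewrite addr0; apply: eq_bigl => i; rewrite in_allI.
  by move=> /andP[_ /tz].
- rewrite xE (bigID (mem (zeros allI (slack c b)))) /= [X in _ + X]big1 => [|i].
    by rewrite addr0; apply: eq_bigl => i; rewrite in_allI.
  by move=> /andP[_ /tz ->]; rewrite scale0r.
Qed.

Lemma slack_ge0P c b :
  (forall x, vhull allI x -> (x *m c) 0 0 <= b) <->
  (forall i, 0 <= slack c b i).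
Proof.
split=> [le i|y0 x /vhullP[t [t0 t1 ->]]].
  by rewrite ffunE subr_ge0; apply/le/vhull_v.
rewrite -subr_ge0 -mul_sum_slack // sumr_ge0 // => i _.
by rewrite mulr_ge0.
Qed.

Lemma is_face_vhull F : is_face (vhull allI) F <->
  exists2 Z, Z \in cone_faces slack_space allI & F = vhull Z.
Proof.
split=> [[c [b [le ->]]]|[Z /cone_facesP[_ /slack_spaceP[c [b ->]]] [y0 ->]] ->].
  have y0 := (slack_ge0P c b).1 le.
  exists (zeros allI (slack c b)); last by rewrite vhull_zeros.
  by apply/cone_facesP; exists (slack c b); [exact: slack_mem | split].
have {}y0 i : 0 <= slack c b i by apply/y0/in_allI.
by exists c, b; rewrite vhull_zeros //; split=> //; apply/slack_ge0P.
Qed.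

(** A face contains a point of the configuration exactly if the exposing slack vector
    vanishes there. *)
Lemma vhull_inj : {in cone_faces slack_space allI &, injective vhull}.
Proof.
have sub Z Z' : Z' \in cone_faces slack_space allI -> vhull Z = vhull Z' -> Z \subset Z'.
  move=> /cone_facesP[_ /slack_spaceP[c [b ->]] [y0 ->]] eqZ.
  apply/fintype.subsetP => i /vhull_v; rewrite eqZ vhull_zeros; last first.
    by move=> k; apply: y0; rewrite in_allI.
  by move=> [_ /= vi]; rewrite mem_zeros in_allI ffunE vi subrr eqxx.
by move=> Z Z' Zf Z'f eqZ; apply/eqP; rewrite finset.eqEsubset !sub.
Qed.

Lemma affine_combP (A : set 'rV[R]_m) (T : finType) (a : T -> 'rV[R]_m) (t : T -> R) :
  (forall i, A (a i)) -> \sum_i t i = 1 -> affine_hull A (\sum_i t i *: a i).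
Proof.
move=> aA t1; exists #|T|, (fun l => a (enum_val l)), (fun l => t (enum_val l)).
split=> //; last by rewrite (reindex _ (onW_bij _ (@enum_val_bij T))).
by rewrite -t1 [RHS](reindex _ (onW_bij _ (@enum_val_bij T))).
Qed.

Lemma affine_hull_vhull i0 Z : i0 \in Z ->
  affine_hull (vhull Z) = [set v i0 + u | u in [set u | u \in direction_space i0 Z]].
Proof.
move=> i0Z; apply/seteqP; split=> x.
  have hull_dirs y : vhull Z y -> y - v i0 \in direction_space i0 Z.
    move=> /vhullP[t [_ t1 ->]]; rewrite -[v i0]scale1r -t1 scaler_suml -sumrB.
    rewrite memv_suml // => i iZ; rewrite -scalerBr memvZ //.
    exact/(subvP (sumv_sup i iZ (subvv _)))/memv_line.
  move=> [k [a [t [aZ t1 ->]]]] /=.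
  exists (\sum_i t i *: a i - v i0); last by rewrite addrC subrK.
  rewrite -[v i0]scale1r -t1 scaler_suml -sumrB memv_suml // => i _.
  by rewrite -scalerBr memvZ // hull_dirs.
move=> [u /memv_sumP[us usP ->] <-].
have /choice[k kP] : forall i, exists k : R, i \in Z -> us i = k *: (v i - v i0).
  move=> i; case: (boolP (i \in Z)) => iZ; last by exists 0.
  by have /vlineP[k ->] := usP _ iZ; exists k.
pose t i := (if i \in Z then k i else 0) +
            (i == i0)%:R * (1 - \sum_(i in Z) k i).
pose a i := if i \in Z then v i else v i0.
have -> : v i0 + \sum_(i in Z) us i = \sum_i t i *: a i.
  under [RHS]eq_bigr do rewrite scalerDl.
  rewrite big_split /= [X in _ = _ + X](bigD1 i0) //= eqxx mul1r.
  rewrite [X in _ = _ + (_ + X)]big1 => [|i /negbTE ->]; last by rewrite mul0r scale0r.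
  rewrite addr0 /a i0Z scalerBl scale1r addrCA; congr (_ + _).
  rewrite scaler_suml big_mkcond /= [X in _ = _ - X]big_mkcond /= -sumrB.
  apply: eq_bigr => i _; case: ifP => iZ; last by rewrite scale0r subrr.
  by rewrite kP // scalerBr.
apply: affine_combP => [i|].
  by rewrite /a; case: ifP => iZ; apply: vhull_v.
rewrite big_split /= -big_mkcond /= [X in _ + X](bigD1 i0) //= eqxx mul1r.
rewrite [X in _ + (_ + X)]big1 => [|i /negbTE ->]; last by rewrite mul0r.
by rewrite addr0 addrC subrK.
Qed.

Lemma has_dim_vhull d Z : has_dim d (vhull Z) <-> rk slack_space Z = d.+1.
Proof.
have [->|[i0 i0Z]] := set_0Vmem Z.
  rewrite rk_set0; split=> // -[a [U [_ eqU]]]; exfalso.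
  have : affine_hull (vhull finset.set0) (a + 0).
    by rewrite eqU; exists 0 => //=; rewrite mem0v.
  move=> [k [b [t [bP t1 _]]]].
  case: k b t bP t1 => [|k] b t bP; first by rewrite big_ord0 => /esym/eqP; rewrite oner_eq0.
  have /vhullP[s [_]] := bP ord0; rewrite big_set0 => /esym/eqP.
  by rewrite oner_eq0.
rewrite (rk_slack v i0Z) /has_dim (affine_hull_vhull i0Z).
split=> [[a [U [dU eqU]]]|[dU]]; last by exists (v i0), (direction_space i0 Z).
congr _.+1; rewrite -dU; congr (\dim _).
have mem_iff u :
    (v i0 + u \in [set v i0 + u | u in [set u | u \in direction_space i0 Z]]) =
    (u \in direction_space i0 Z).
  apply/idP/idP => [|uD].
    by rewrite inE => -[w /= wD /addrI <-].
  by rewrite inE; exists u.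
have i0U : v i0 - a \in U.
  have : v i0 + 0 \in [set v i0 + u | u in [set u | u \in direction_space i0 Z]].
    by rewrite mem_iff mem0v.
  by rewrite eqU inE => -[w /= wU]; rewrite addr0 => <-; rewrite addrC addKr.
apply/vspaceP => u; rewrite -mem_iff eqU.
have -> : v i0 + u = a + (v i0 - a + u) by rewrite addrA [a + _]addrC subrK.
apply/idP/idP => [|uU].
  by rewrite inE => -[w /= wU /addrI wE]; move: wU; rewrite wE rpredDl.
by rewrite inE; exists (v i0 - a + u) => //=; rewrite memvD.
Qed.

(** Through [vhull] the face numbers of a polytope become the rank numbers of its slack
    space. *)
Lemma f_vhull k :
  f_ k (vhull allI) = #|rk_faces slack_space allI k.+1|.
Proof.
set S := rk_faces _ _ _; apply: card_fset_set.
have -> : faces k (vhull allI) = vhull @` [set` S].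
  apply/seteqP; split=> F.
    move=> [/is_face_vhull[Z Zf ->] /has_dim_vhull rkZ].
    by exists Z => //=; rewrite in_rk_faces Zf rkZ eqxx.
  move=> [Z /=]; rewrite in_rk_faces => /andP[Zf /eqP rkZ] <-.
  by split; [apply/is_face_vhull; exists Z | apply/has_dim_vhull].
apply: card_eq_trans (inj_card_eq _) _.
  move=> Z Z'; rewrite !inE /= !in_rk_faces => /andP[Zf _] /andP[Z'f _].
  exact: vhull_inj.
have -> : [set` S] = (fun l => nth finset.set0 (enum S) l) @` `I_#|S|.
  apply/seteqP; split=> Z /=.
    move=> ZS; exists (index Z (enum S)); rewrite /= ?cardE ?index_mem ?nth_index ?mem_enum //.
  by move=> [l /= lS <-]; rewrite -mem_enum mem_nth -?cardE.
apply: inj_card_eq => l l'; rewrite !inE /= => lS lS' /eqP.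
by rewrite nth_uniq ?enum_uniq -?cardE // => /eqP.
Qed.

Lemma polytope_vhull Z : polytope (vhull Z).
Proof.
exists [set v i | i in [set` Z]] => //.
exact/finite_image/finite_finset.
Qed.

End Hull.

Lemma polytope_is_vhull (R : realType) m (P : set 'rV[R]_m) : polytope P ->
  exists n (v : 'I_n -> 'rV[R]_m), P = vhull v [set: 'I_n]%SET.
Proof.
move=> [V /finite_seqP[s ->] ->].
exists (size s), (fun i => nth 0 s i); congr convex_hull.
apply/seteqP; split=> x /=.
  move=> xs; have lt : (index x s < size s)%N by rewrite index_mem.
  by exists (Ordinal lt) => //=; rewrite ?nth_index ?inE.
by move=> [i _ <-]; rewrite mem_nth.
Qed.

(** * Realized and excluded pairs of face numbers *)

Section Realized.
Variable R : realType.

Lemma Pi12_vhull (I : finType) m (v : I -> 'rV[R]_m) (x : 'rV[R]_2) :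
    rk (slack_space v) [set: I]%SET = 5%N ->
    x 0 0 = #|rk_faces (slack_space v) [set: I]%SET 2%N|%:R ->
    x 0 1 = #|rk_faces (slack_space v) [set: I]%SET 3%N|%:R ->
  Pi12_F4 (R := R) x.
Proof.
move=> rk5 x0 x1; exists m, (vhull v [set: I]%SET); split.
- exact: polytope_vhull.
- exact/has_dim_vhull.
- by rewrite f_vhull.
- by rewrite f_vhull.
Qed.

Lemma Pi12_bounds (x : 'rV[R]_2) : Pi12_F4 (R := R) x -> exists a b c : nat,
  [/\ x 0 0 = b%:R, x 0 1 = c%:R & (a + uphalf c <= b <= 'C(a, 2))%N].
Proof.
move=> [m [P [/polytope_is_vhull[n [v ->]] /has_dim_vhull rk5 x0 x1]]].
rewrite !f_vhull in x0 x1; do 3!eexists; split; [exact: x0 | exact: x1 |].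
exact: rk5_bounds (pointed_slack v [set: _]%SET) rk5.
Qed.

Lemma Pi12_family m d (x : 'rV[R]_2) : (1 < m)%N -> (2 < m + d)%N ->
    x 0 0 = ('C((m + d).+3, 2) - d)%N%:R ->
    x 0 1 = (2 * ('C((m + d).+3, 2) - d - (m + d).+3))%N%:R ->
  Pi12_F4 (R := R) x.
Proof.
move=> m1 md2; pose h : R := (m%:R - 1) ^+ 2.
have h0 : 0 < h by rewrite exprn_gt0 // subr_gt0 ltr1n.
(* With this [ga] the difference [al - et] is [ga / 2]. *)
pose ga := (4 * h + 2)^-1; pose al := (1 - ga) / 2; pose et := 2 * h * ga.
have den : 0 < 4 * h + 2 by lra.
have ga0 : 0 < ga by rewrite invr_gt0.
have gaK : 4 * h * ga + 2 * ga = 1 by rewrite -mulrDl divff // gt_eqF.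
have hga : 0 < h * ga by rewrite mulr_gt0.
have al0 : 0 < al by rewrite /al; lra.
have alga : 2 * al + ga = 1 by rewrite /al; lra.
have etal : et < al by rewrite /et /al; lra.
have etE : et = 2 * (m%:R - 1) ^+ 2 * ga by [].
move=> x0 x1; apply: (@Pi12_vhull _ _ (fampt (m := m) (d := d) al ga et)).
- exact: rk_family.
- by rewrite family_edges.
- by rewrite family_2faces.
Qed.

Lemma Pi12_square_pyramid (x : 'rV[R]_2) :
  x 0 0 = 13 -> x 0 1 = 13 -> Pi12_F4 (R := R) x.
Proof.
move=> x0 x1; have [rk5 n2 n3] := square_pyramid_counts R.
by apply: (Pi12_vhull rk5); rewrite ?n2 ?n3.
Qed.

End Realized.

Lemma double_bin2 n : (2 * 'C(n, 2) = n * n.-1)%N.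
Proof. by rewrite -mul_bin_diag bin1. Qed.

Section Eventually.
Variable R : realType.

Definition eventually_decided (Q : R -> Prop) := exists N : R,
  (forall t, N <= t -> Q t) \/ (forall t, N <= t -> ~ Q t).

Lemma eventually_decided_and Q Q' : eventually_decided Q ->
  eventually_decided Q' -> eventually_decided (fun t => Q t /\ Q' t).
Proof.
move=> [N QN] [N' Q'N']; exists (Num.max N N').
case: QN => QN; last by right=> t; rewrite ge_max => /andP[/QN nQ _] [].
case: Q'N' => Q'N'; last by right=> t; rewrite ge_max => /andP[_ /Q'N' nQ] [].
by left=> t; rewrite ge_max => /andP[/QN q /Q'N' q'].
Qed.

Lemma eventually_decided_ext Q Q' : (forall t, Q t <-> Q' t) ->
  eventually_decided Q -> eventually_decided Q'.
Proof.
move=> QQ' [N QN]; exists N.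
by case: QN => QN; [left=> t /QN/QQ' | right=> t /QN nQ /QQ'].
Qed.

Lemma eventually_decided_all (T : Type) (s : seq T) (Q : T -> R -> bool) :
  (forall p, eventually_decided (Q p)) ->
  eventually_decided (fun t => all (Q^~ t) s).
Proof.
move=> Qdec; elim: s => [|p s IHs] /=; first by exists 0; left.
apply: eventually_decided_ext (eventually_decided_and (Qdec p) IHs) => t.
by split=> [[-> ->]|/andP[]].
Qed.

Lemma eventually_decided_exists k (Q : 'I_k -> R -> Prop) :
  (forall i, eventually_decided (Q i)) ->
  eventually_decided (fun t => exists i, Q i t).
Proof.
move=> Qdec; case: (pselect (exists i N, forall t, N <= t -> Q i t)).
  by move=> [i [N QN]]; exists N; left=> t /QN q; exists i.
move=> np; have /choice[N NP] : forall i, exists N, forall t, N <= t -> ~ Q i t.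
  move=> i; have [N [QN|QN]] := Qdec i; last by exists N.
  by exfalso; apply: np; exists i, N.
exists (\sum_i `|N i|); right=> t le [i]; apply: NP; apply: le_trans le.
by rewrite (bigD1 i) //= (le_trans (ler_norm _)) // lerDl sumr_ge0.
Qed.

Lemma poly_eventual_sign (p : {poly R}) : exists N : R,
  [\/ forall t, N <= t -> p.[t] = 0, forall t, N <= t -> 0 < p.[t]
    | forall t, N <= t -> p.[t] < 0].
Proof.
case: (ltrgtP (lead_coef p) 0) => [lt|gt|/eqP].
- have [|N NP] := @poly_pinfty_gt_lc _ (- p); first by rewrite lead_coefN oppr_gt0.
  exists N; apply: Or33 => t /NP; rewrite lead_coefN hornerN lerN2.
  by move=> /le_lt_trans; apply.
- have [N NP] := poly_pinfty_gt_lc gt; exists N; apply: Or32 => t /NP.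
  exact: lt_le_trans.
- rewrite lead_coef_eq0 => /eqP ->; exists 0; apply: Or31 => t _.
  by rewrite horner0.
Qed.

Lemma eventually_decided_sign (p : {poly R}) :
  [/\ eventually_decided (fun t => p.[t] == 0),
      eventually_decided (fun t => 0 <= p.[t]) &
      eventually_decided (fun t => 0 < p.[t])].
Proof.
have [N NP] := poly_eventual_sign p; case: NP => NP; split; exists N.
- by left=> t /NP ->; rewrite eqxx.
- by left=> t /NP ->; rewrite lexx.
- by right=> t /NP ->; rewrite ltxx.
- by right=> t /NP lt; rewrite gt_eqF.
- by left=> t /NP /ltW.
- by left=> t /NP.
- by right=> t /NP lt; rewrite lt_eqF.
- by right=> t /NP lt; rewrite leNgt lt.
- by right=> t /NP lt; rewrite ltNge ltW.
Qed.

Variables (n : nat) (g : 'I_n -> {poly R}).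

Definition poly_curve (t : R) : 'rV[R]_n := \row_j (g j).[t].

Lemma peval_poly_curve (p : mpoly.mpoly n R) :
  exists q : {poly R}, forall t, peval p (poly_curve t) = q.[t].
Proof.
exists (\sum_(m <- mpoly.msupp p)
  (mpoly.mcoeff m p)%:P * \prod_i g i ^+ (mpoly.fun_of_multinom m i)) => t.
rewrite /peval mpoly.mevalE horner_sum; apply: eq_bigr => m _.
rewrite hornerM hornerC horner_prod; congr (_ * _).
by apply: eq_bigr => i _; rewrite mxE horner_exp.
Qed.

Lemma eventually_decided_curve (S : set 'rV[R]_n) : semialgebraic S ->
  eventually_decided (fun t => S (poly_curve t)).
Proof.
move=> [k [B [Bbasic ->]]].
apply: (@eventually_decided_ext (fun t => exists i, B i (poly_curve t))).
  by move=> t; split=> [[i Bi]|[i _ Bi]]; exists i.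
apply: eventually_decided_exists => i; have [eqs [ges [gts ->]]] := Bbasic i.
have sgn (p : mpoly.mpoly n R) :
    [/\ eventually_decided (fun t => peval p (poly_curve t) == 0),
        eventually_decided (fun t => 0 <= peval p (poly_curve t)) &
        eventually_decided (fun t => 0 < peval p (poly_curve t))].
  have [q qE] := peval_poly_curve p; have [d0 dge dgt] := eventually_decided_sign q.
  by split; [apply: eventually_decided_ext d0 | apply: eventually_decided_ext dge
    | apply: eventually_decided_ext dgt] => t; rewrite qE.
apply: (@eventually_decided_ext (fun t =>
  (all (fun p => peval p (poly_curve t) == 0) eqs /\
   all (fun p => 0 <= peval p (poly_curve t)) ges) /\
   all (fun p => 0 < peval p (poly_curve t)) gts)).
  by move=> t; split=> [[[]]|[]].
apply: eventually_decided_and; last first.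
  by apply: eventually_decided_all => p; have [] := sgn p.
by apply: eventually_decided_and; apply: eventually_decided_all => p; have [] := sgn p.
Qed.

End Eventually.

Definition pt2 (R : realType) (a b : R) : 'rV[R]_2 :=
  \row_j (if j == 0 then a else b).

(** The first two pairs differ by (1, 2), and together with the third one they also give
    (0, -1). *)
Lemma lattice_has_integral_points (R : realType) (L : set 'rV[R]_2) (a b : int) :
    affine_lattice L -> (forall x, Pi12_F4 (R := R) x -> L x) ->
  L (pt2 a%:~R b%:~R).
Proof.
move=> [_ _ Laff] PL.
have L0 : L (pt2 15 18).
  by apply/PL/(@Pi12_family _ 3 0) => //; rewrite mxE.
have L1 : L (pt2 14 16).
  by apply/PL/(@Pi12_family _ 2 1) => //; rewrite mxE.
have L2 : L (pt2 13 13) by apply/PL/Pi12_square_pyramid; rewrite mxE.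
(* Coordinates of (a, b) with respect to (15, 18), (1, 2) and (0, -1). *)
pose s := a - 15; pose r := 18 + 2 * s - b.
pose pts := [:: pt2 15 18; pt2 14 16; pt2 13 13 : 'rV[R]_2].
pose cs := [:: 1 + s + r; - s - 2 * r; r].
have -> : pt2 a%:~R b%:~R = \sum_(i < 3) pts`_i *~ cs`_i.
  rewrite !big_ord_recl big_ord0 /= addr0 -!scaler_int; apply/rowP => j.
  by rewrite !mxE /s /r; case: eqP => _;
    rewrite !(intrB, intrD, intrM, intrN); ring.
apply: Laff.
  by move=> [[|[|[|i]]] ?].
by rewrite !big_ord_recl big_ord0 /= /s; ring.
Qed.

Section Curve.
Variable R : realType.

(** Here [u = f_1 - f_2 / 2] is [4 * t + 1] and [f_1] is [u * (u - 1) / 2 - t]. *)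
Definition curve : R -> 'rV[R]_2 := poly_curve (fun j : 'I_2 =>
  if j == 0 then 8 *: 'X^2 + 'X else 16 *: 'X^2 - 6 *: 'X - 2%:P).

Lemma curveE t : curve t = pt2 (8 * t ^+ 2 + t) (16 * t ^+ 2 - 6 * t - 2).
Proof.
by apply/rowP => j; rewrite !mxE; case: ifP => _; rewrite !hornerE ?hornerXn.
Qed.

(** A member of the family with [4 * k + 1] vertices and [k] missing edges. *)
Lemma curve_in k : (1 < k)%N -> Pi12_F4 (R := R) (curve k%:R).
Proof.
move=> k1; rewrite curveE.
have e1 : (3 * k - 2 + k).+3 = (4 * k).+1 by lia.
have := double_bin2 (4 * k).+1; rewrite /= => binE.
apply: (@Pi12_family _ (3 * k - 2) k); [lia | lia | |]; rewrite e1 mxE /=.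
  have -> : ('C((4 * k).+1, 2) - k)%N = (8 * (k * k) + k)%N.
    nia.
  by rewrite natrD !natrM.
have -> : (2 * ('C((4 * k).+1, 2) - k - (4 * k).+1))%N = (16 * (k * k) - 6 * k - 2)%N.
  nia.
rewrite !natrB; [by rewrite !natrM | nia | nia].
Qed.

(** Here [u] is [4 * k + 1 / 2], so there are at most [4 * k] vertices, and these span
    fewer than [f_1] edges. *)
Lemma curve_out k : (1 < k)%N -> ~ Pi12_F4 (R := R) (curve (k%:R - 8^-1)).
Proof.
move=> k1 /Pi12_bounds[a [b [c]]]; rewrite curveE !mxE /= => -[bE cE].
have {}bE : b = (8 * (k * k) - k)%N.
  apply/eqP; rewrite -(eqr_nat R) -bE natrB; last nia.
  by rewrite !natrM; apply/eqP; field.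
have {}cE : c = (16 * (k * k) - 10 * k - 1)%N.
  apply/eqP; rewrite -(eqr_nat R) -cE !natrB; try nia.
  by rewrite !natrM; apply/eqP; field.
have := double_bin2 a; move: bE cE => -> -> bin /andP[].
have -> : uphalf (16 * (k * k) - 10 * k - 1) = (8 * (k * k) - 5 * k)%N.
  by rewrite uphalfE; lia.
move=> le1 le2; have : (a <= 4 * k)%N by nia.
nia.
Qed.

End Curve.

Theorem theorem1p3 (R : realType) :
  ~ semialgebraic_lattice_points (Pi12_F4 (R := R)).
Proof.
move=> [S [L [Salg Llat _ PE]]].
have PL x : Pi12_F4 (R := R) x -> L x by rewrite PE => -[].
have [N SN] : eventually_decided (fun t => S (curve t)) := eventually_decided_curve _ Salg.
pose k := (Num.bound `|N|).+2.
have Nk : N <= k%:R - 8^-1.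
  have := archi_boundP (normr_ge0 N); have := ler_norm N.
  have e : (8%:R : R)^-1 <= 1 by rewrite invf_le1 // ler1n.
  by rewrite /k -addn2 natrD; move: (_%:R : R) => ?; lra.
have Nk' : N <= k%:R by apply: le_trans Nk _; rewrite lerBlDr lerDl invr_ge0.
case: SN => SN; last first.
  by have := @curve_in R k isT; rewrite PE => -[/(SN _ Nk')].
apply: (@curve_out R k isT); rewrite PE; split; first exact: SN.
have -> : curve (k%:R - 8^-1) =
    pt2 (8 * (k%:Z * k%:Z) - k%:Z)%:~R (16 * (k%:Z * k%:Z) - 10 * k%:Z - 1)%:~R :> 'rV[R]_2.
  by rewrite curveE !intrB !intrM; congr pt2; field.
exact: lattice_has_integral_points.
Qed.
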